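(* Consider the original problem (P), the barrier problem (B) with parameter $c>0$, the resource problem (Y), and the algorithm DRRA, as described in the context. Assume: (a) for each $i\in\mathcal V$, $f_i$ is convex and twice continuously differentiable on $\mathcal X_i=\{x\in\mathbb R^{d_i}: g_i^j(x)\le 0,\ j=1,\dots,p_i\}$, where each $g_i^j:\mathbb R^{d_i}\to\mathbb R$ is convex and twice continuously differentiable; (b) there exist $\tilde x_i\in\mathbb R^{d_i}$, $i\in\mathcal V$, with $g_i^j(\tilde x_i)<0$ for all $i\in\mathcal V$ and $j=1,\dots,p_i$, $\sum_{i\in\mathcal V}A_i^{\text{in}}\tilde x_i\le b^{\text{in}}$ and $\sum_{i\in\mathcal V}A_i^{\text{eq}}\tilde x_i=b^{\text{eq}}$; (c) the feasible set of (P) is compact; (d) each $A_i=[(A_i^{\text{in}})^T,(A_i^{\text{eq}})^T]^T$ has full row rank, i.e. $\operatorname{rank}(A_i)=m^{\text{in}}+m^{\text{eq}}$; (e) for any $i\in\mathcal V$ and $k\ge 0$, $i\in U_k$ with a probability $p_i^k\ge\tilde p$ for some $\tilde p>0$; (f) $\{y_i^0\}_{i\in\mathcal V}$ is feasible to (Y). Let $\{x_i^k\}_{i\in\mathcal V}$, $k\ge 0$, be generated by DRRA. Then $\{x_i^k\}_{i\in\mathcal V}$ is feasible to problems (B) and (P) for all $k\ge 0$. In addition: 1) with probability $1$, $\lim_{k\to\infty}\sum_{i\in\mathcal V}F_i(x_i^k)=F^\star$, where $F^\star$ is the optimal value of (B); 2) for any $\epsilon>0$, there exists $\bar c>0$ such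 that when $c\in(0,\bar c]$, the following holds with probability $1$: $\lim_{k\to\infty}\sum_{i\in\mathcal V}f_i(x_i^k)\le f^\star+\epsilon$, where $f^\star$ is the optimal value of (P).
   Context: Network: $\mathcal G=(\mathcal V,\mathcal E)$ is an undirected connected graph, $\mathcal V=\{1,\dots,n\}$, and $\mathcal N_i=\{j:\{i,j\}\in\mathcal E\}$ is the neighbor set of $i$. Data: for $i\in\mathcal V$, $f_i:\mathbb R^{d_i}\to\mathbb R$, $A_i^{\text{in}}\in\mathbb R^{m^{\text{in}}\times d_i}$, $A_i^{\text{eq}}\in\mathbb R^{m^{\text{eq}}\times d_i}$, $\mathcal X_i\subseteq\mathbb R^{d_i}$; $b^{\text{in}}\in\mathbb R^{m^{\text{in}}}$, $b^{\text{eq}}\in\mathbb R^{m^{\text{eq}}}$; $m=m^{\text{in}}+m^{\text{eq}}$, $b=[(b^{\text{in}})^T,(b^{\text{eq}})^T]^T$. Vector inequalities are componentwise. (P): minimize $\sum_{i\in\mathcal V}f_i(x_i)$ over $x_i\in\mathcal X_i$, $i\in\mathcal V$, subject to $\sum_{i\in\mathcal V}A_i^{\text{in}}x_i\le b^{\text{in}}$ and $\sum_{i\in\mathcal V}A_i^{\text{eq}}x_i=b^{\text{eq}}$. Barrier: $\tilde{\mathcal X}_i=\{x\in\mathbb R^{d_i}: g_i^j(x)<0,\ j=1,\dots,p_i\}$. For each $i,j$, a barrier function $B_i^j:\{x\in\mathbb R^{d_i}:g_i^j(x)<0\}\to\mathbb R$ is fixed such that $B_i^j(x_i)\to+\infty$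 whenever $g_i^j(x_i)\to 0$ from negative values, and $B_i^j$ is convex and twice continuously differentiable on $\tilde{\mathcal X}_i$. For $c>0$, $F_i(x_i)=f_i(x_i)+c\sum_{j=1}^{p_i}B_i^j(x_i)$. (B): minimize $\sum_{i\in\mathcal V}F_i(x_i)$ over $x_i\in\tilde{\mathcal X}_i$, $i\in\mathcal V$, subject to $\sum_{i\in\mathcal V}A_i^{\text{in}}x_i\le b^{\text{in}}$ and $\sum_{i\in\mathcal V}A_i^{\text{eq}}x_i=b^{\text{eq}}$. Subproblem (S) for node $i$ and $y_i=[(y_i^{\text{in}})^T,(y_i^{\text{eq}})^T]^T\in\mathbb R^m$: minimize $F_i(x_i)$ over $x_i\in\tilde{\mathcal X}_i$ subject to $A_i^{\text{in}}x_i\le y_i^{\text{in}}$, $A_i^{\text{eq}}x_i=y_i^{\text{eq}}$. Its optimal value is $\phi_i(y_i)$ ($+\infty$ if infeasible). (Y): minimize $\sum_{i\in\mathcal V}\phi_i(y_i)$ over $y_i\in\mathbb R^m$, $i\in\mathcal V$, subject to $\sum_{i\in\mathcal V}y_i=b$. A family $\{y_i\}_{i\in\mathcal V}$ is feasible to (Y) if $\sum_{i\in\mathcal V}y_i=b$ and $\phi_i(y_i)<+\infty$ for all $i$. Algorithm DRRA: start from $\{y_i^0\}$ feasible to (Y), and let $x_i^0$ be an optimal solution of (S) with $y_i=y_i^0$. At each iteration $k\ge 0$ a set $U_k\subseteq\mathcal V$ is formed (possibly at random) with $(\mathcal N_i\cup\{i\})\cap(\mathcal N_j\cup\{j\})=\emptyset$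 for all distinct $i,j\in U_k$. For each $i\in U_k$, $\{x_j^{k+1}\}_{j\in\mathcal N_i\cup\{i\}}$ is an optimal solution of: minimize $\sum_{j\in\mathcal N_i\cup\{i\}}F_j(x_j)$ over $x_j\in\tilde{\mathcal X}_j$, $j\in\mathcal N_i\cup\{i\}$, subject to $\sum_{j\in\mathcal N_i\cup\{i\}}A_j^{\text{in}}x_j\le\sum_{j\in\mathcal N_i\cup\{i\}}y_j^{\text{in},k}$ and $\sum_{j\in\mathcal N_i\cup\{i\}}A_j^{\text{eq}}x_j=\sum_{j\in\mathcal N_i\cup\{i\}}y_j^{\text{eq},k}$; and for $j\in\mathcal N_i\cup\{i\}$, $y_j^{\text{in},k+1}=A_j^{\text{in}}x_j^{k+1}+\frac{1}{|\mathcal N_i|+1}\sum_{\ell\in\mathcal N_i\cup\{i\}}(y_\ell^{\text{in},k}-A_\ell^{\text{in}}x_\ell^{k+1})$, $y_j^{\text{eq},k+1}=A_j^{\text{eq}}x_j^{k+1}$. For $i\notin\bigcup_{j\in U_k}(\mathcal N_j\cup\{j\})$, $x_i^{k+1}=x_i^k$ and $y_i^{k+1}=y_i^k$. Under assumptions (a)–(d) and (f) these optimal solutions exist.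
   Formalization: In part 2 the limit is replaced by the limit superior, since the limit need not exist when (B) has several optimal solutions; in (e) the probability that i is in U_k is at least p̃ conditionally on the past of the algorithm, since the claim fails with only unconditional probabilities. *)

(* Defs.v *)
From HB Require Import structures.
From mathcomp Require Import all_boot all_order all_algebra.
From mathcomp Require Import all_classical all_reals all_analysis.
Set Implicit Arguments.
Unset Strict Implicit.
Unset Printing Implicit Defensive.
Import Order.TTheory GRing.Theory Num.Theory.
Import numFieldNormedType.Exports.
Local Open Scope classical_set_scope.
Local Open Scope ring_scope.

(* The derivatives are taken relative to [S].  For [S] open this is the usual
   notion; for [S] closed it only involves the values of [h] on [S], and it is
   implied by [h] being C^2 on an open neighbourhood of [S]. *)
Definition derivative_on (R : realType) (d q : nat) (S : set 'cV[R]_d)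
    (h : 'cV[R]_d -> 'cV[R]_q) (J : 'M[R]_(q, d)) (x : 'cV[R]_d) : Prop :=
  forall eps : R, 0 < eps -> \forall z \near within S (nbhs x),
    `|h z - h x - J *m (z - x)| <= eps * `|z - x|.

Definition C2_on (R : realType) (d : nat) (S : set 'cV[R]_d)
    (h : 'cV[R]_d -> R) : Prop :=
  exists (grad : 'cV[R]_d -> 'rV[R]_d) (hess : 'cV[R]_d -> 'M[R]_d),
    [/\ forall x, S x -> derivative_on S (fun z => (h z)%:M : 'cV[R]_1) (grad x) x,
        forall x, S x -> derivative_on S (fun z => (grad z)^T) (hess x) x
      & {within S, continuous hess}].

Definition lev (R : realType) (m : nat) (u v : 'cV[R]_m) : Prop :=
  forall r, u r 0 <= v r 0.

Definition optval (R : realType) (T : Type) (D : set T) (h : T -> R) : \bar R :=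
  ereal_inf [set (h z)%:E | z in D].

Definition is_optimal (R : realType) (T : Type) (D : set T) (h : T -> R)
    (z : T) : Prop :=
  D z /\ forall z', D z' -> h z <= h z'.

Definition connected_graph (n : nat) (e : rel 'I_n) : Prop :=
  [/\ symmetric e, irreflexive e & forall i j, connect e i j].

Definition nbr (n : nat) (e : rel 'I_n) (i : 'I_n) : {set 'I_n} :=
  [set j | e i j]%SET.

Definition cnbr (n : nat) (e : rel 'I_n) (i : 'I_n) : {set 'I_n} :=
  (i |: nbr e i)%SET.

Record problem (R : realType) (n : nat) := Problem {
  xdim : 'I_n -> nat;
  m_in : nat;
  m_eq : nat;
  ncon : 'I_n -> nat;
  f : forall i, 'cV[R]_(xdim i) -> R;
  g : forall i, 'I_(ncon i) -> 'cV[R]_(xdim i) -> R;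
  Ain : forall i, 'M[R]_(m_in, xdim i);
  Aeq : forall i, 'M[R]_(m_eq, xdim i);
  bin : 'cV[R]_m_in;
  beq : 'cV[R]_m_eq
}.

Arguments f {R n} _ i x.
Arguments g {R n} _ i j x.

Section Problem.
Variables (R : realType) (n : nat) (Q : problem R n).

Definition profile := forall i, 'cV[R]_(xdim Q i).

(* An allocation stacks the inequality part (upper block) on top of the
   equality part (lower block). *)
Definition alloc := 'I_n -> 'cV[R]_(m_in Q + m_eq Q).

Definition A (i : 'I_n) : 'M[R]_(m_in Q + m_eq Q, xdim Q i) :=
  col_mx (Ain Q i) (Aeq Q i).

Definition b : 'cV[R]_(m_in Q + m_eq Q) := col_mx (bin Q) (beq Q).

Definition X (i : 'I_n) : set 'cV[R]_(xdim Q i) :=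
  [set x | forall j, g Q i j x <= 0].

Definition Xt (i : 'I_n) : set 'cV[R]_(xdim Q i) :=
  [set x | forall j, g Q i j x < 0].

Arguments X : clear implicits.
Arguments Xt : clear implicits.

Definition coupling (z : profile) : Prop :=
  lev (\sum_i Ain Q i *m z i) (bin Q) /\ \sum_i Aeq Q i *m z i = beq Q.

Definition feasibleP : set profile :=
  [set z | (forall i, X i (z i)) /\ coupling z].

Definition feasibleB : set profile :=
  [set z | (forall i, Xt i (z i)) /\ coupling z].

Definition fstar : \bar R := optval feasibleP (fun z => \sum_i f Q i (z i)).

(* Only the values of [B i j] on [g i j x < 0] are ever used. *)
Definition barriers := forall i, 'I_(ncon Q i) -> 'cV[R]_(xdim Q i) -> R.

Definition is_barrier (B : barriers) : Prop :=
  forall i (j : 'I_(ncon Q i)),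
    [/\ forall M : R, exists2 delta : R, 0 < delta &
          forall x, - delta < g Q i j x -> g Q i j x < 0 -> M <= B i j x,
        convex_function (Xt i) (B i j)
      & C2_on (Xt i) (B i j)].

Variables (B : barriers) (c : R).

Definition F (i : 'I_n) (x : 'cV[R]_(xdim Q i)) : R :=
  f Q i x + c * \sum_j B j x.

Arguments F : clear implicits.

Definition Fstar : \bar R := optval feasibleB (fun z => \sum_i F i (z i)).

Definition feasibleS (i : 'I_n) (u : 'cV[R]_(m_in Q + m_eq Q)) :
    set 'cV[R]_(xdim Q i) :=
  [set x | [/\ Xt i x, lev (Ain Q i *m x) (usubmx u) & Aeq Q i *m x = dsubmx u]].

Arguments feasibleS : clear implicits.

Definition phi (i : 'I_n) (u : 'cV[R]_(m_in Q + m_eq Q)) : \bar R :=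
  optval (feasibleS i u) (F i).

Definition feasibleY (y : alloc) : Prop :=
  \sum_i y i = b /\ forall i, (phi i (y i) < +oo)%E.

Variable e : rel 'I_n.

(* The decision variable is the whole family [z], but neither the feasible set
   nor the objective depends on the components outside [cnbr e i]. *)
Definition feasible_block (i : 'I_n) (y : alloc) : set profile :=
  [set z | [/\ forall j, j \in cnbr e i -> Xt j (z j),
     lev (\sum_(j in cnbr e i) Ain Q j *m z j)
         (\sum_(j in cnbr e i) usubmx (y j))
   & \sum_(j in cnbr e i) Aeq Q j *m z j = \sum_(j in cnbr e i) dsubmx (y j)]].

Definition block_cost (i : 'I_n) (z : profile) : R :=
  \sum_(j in cnbr e i) F j (z j).

Record DRRA (y0 : alloc) (U : nat -> {set 'I_n})
    (x : nat -> profile) (y : nat -> alloc) : Prop := {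
  y_init : y 0%N = y0;
  x_init : forall i, is_optimal (feasibleS i (y 0%N i)) (F i) (x 0%N i);
  U_disjoint : forall k i j, i \in U k -> j \in U k -> i != j ->
    [disjoint cnbr e i & cnbr e j]%B;
  x_step : forall k i, i \in U k ->
    is_optimal (feasible_block i (y k)) (block_cost i) (x k.+1);
  y_step : forall k i j, i \in U k -> j \in cnbr e i ->
    y k.+1 j =
      col_mx (Ain Q j *m x k.+1 j + (#|nbr e i|.+1%:R)^-1 *:
                \sum_(l in cnbr e i) (usubmx (y k l) - Ain Q l *m x k.+1 l))
             (Aeq Q j *m x k.+1 j);
  xy_idle : forall k i, (forall j, j \in U k -> i \notin cnbr e j) ->
    x k.+1 i = x k i /\ y k.+1 i = y k i
}.

Variables (disp : measure_display) (Omega : measurableType disp).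
Variables (U : nat -> Omega -> {set 'I_n}).
Variables (x : nat -> Omega -> profile) (y : nat -> Omega -> alloc).

Definition random_variables : Prop :=
  [/\ forall k i, measurable [set w | i \in U k w],
      forall k i r, measurable_fun setT (fun w => x k w i r 0)
    & forall k i r, measurable_fun setT (fun w => y k w i r 0)].

(* The events observable when [U k] is about to be formed: the sigma-algebra
   generated by x^0, ..., x^k, y^0, ..., y^k and U_0, ..., U_(k-1). *)
Definition history (k : nat) : set (set Omega) :=
  <<s [set E | (exists l i r (Y : set R), [/\ (l <= k)%N, measurable Y
                  & E = (fun w => x l w i r 0) @^-1` Y])
            \/ (exists l i r (Y : set R), [/\ (l <= k)%N, measurable Y
                  & E = (fun w => y l w i r 0) @^-1` Y])
            \/ (exists l i, (l < k)%N /\ E = [set w | i \in U l w])] >>.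

(* Says that P(i \in U_k | history k) >= p almost surely, for all i and k; the
   case [E = setT] gives P(i \in U_k) >= p.  The bound has to hold conditionally
   on the past: if U_k = U_0 for all k, with U_0 random, then the unconditional
   probabilities can all be positive while some node is never selected. *)
Definition selection_prob_ge (P : probability Omega R) (p : R) : Prop :=
  forall i k E, history k E ->
    (p%:E * P E <= P (E `&` [set w | i \in U k w]))%E.

End Problem.

Arguments X {R n} Q i.
Arguments Xt {R n} Q i.
Arguments feasibleP {R n} Q.
Arguments feasibleB {R n} Q.
Arguments F {R n Q} B c i x.
Arguments feasibleS {R n} Q i.

(* Main.v *)
(* A state (x, y) consists of primal points x_i feasible for the local problems
   at y_i.  Say that block i gains delta if re-optimizing it lowers the cost by
   more than delta.

   Optimality: if no block gains, then by full row rank each gradient of F_i at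
   x_i is a multiple mu_i A_i, exchanging resources along an edge shows that mu_i
   is the same at both ends, hence a common multiplier exists by connectedness,
   and convexity makes x optimal for (B).

   Uniformity: states of bounded cost stay in a compact set away from the
   boundary (the barriers blow up), and gaining is stable under perturbation, so
   for every eta some delta is gained by some block at every state whose cost
   exceeds the optimum by at least eta.

   Probability: "block i gains delta at time k" is an event of the history, on
   which i is selected with conditional probability at least p, and each such
   selection decreases the cost by at least delta.  As the total decrease is
   bounded, the probabilities of these events are summable over k, so almost
   surely at some time no block gains delta and the cost is within eta of the
   optimum; the cost is nonincreasing. *)
Require Import Defs.
From HB Require Import structures.
From mathcomp Require Import all_boot all_order all_algebra.
From mathcomp Require Import all_classical all_reals all_analysis measurable_realfun.
From mathcomp Require Import ring lra.
Set Implicit Arguments.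
Unset Strict Implicit.
Unset Printing Implicit Defensive.
Import Order.TTheory GRing.Theory Num.Theory.
Import numFieldNormedType.Exports.
Local Open Scope classical_set_scope.
Local Open Scope ring_scope.

(** * Limits and gradients *)

Lemma ler_mx_norm (R : realType) m d (M : 'M[R]_(m, d)) i j : `|M i j| <= `|M|.
Proof.
rewrite [leRHS]/Num.norm /= mx_normrE.
exact: (le_bigmax _ (fun ij => `|M ij.1 ij.2|) (i, j)).
Qed.

Lemma cvg_sumr (R : realType) (V : normedModType R) (I T : Type)
    (G : set_system T) {FG : Filter G} (r : seq I) (p : pred I)
    (u : I -> T -> V) (l : I -> V) :
  (forall i, p i -> u i t @[t --> G] --> l i) ->
  \sum_(i <- r | p i) u i t @[t --> G] --> \sum_(i <- r | p i) l i.
Proof. by move=> ul; apply: cvg_big => // i; exact: add_continuous. Qed.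

Lemma cvg_mxP (R : realType) (T : Type) (G : set_system T) {FG : Filter G} m d
    (u : T -> 'M[R]_(m, d)) (l : 'M[R]_(m, d)) :
  (u t @[t --> G] --> l) <-> (forall i j, u t i j @[t --> G] --> l i j).
Proof.
split=> [ul i j|ul].
  exact: cvg_comp ul (@coord_continuous _ _ _ i j l).
apply/cvgrPdist_lt => eps eps0; near=> t.
rewrite [ltLHS]/Num.norm /= mx_normrE; apply/bigmax_ltP; split=> // -[i j] _ /=.
rewrite !mxE; move: i j.
by near: t; apply: filter_forall => i; apply: filter_forall => j;
  have /cvgrPdist_lt := ul i j; apply.
Unshelve. all: by end_near. Qed.

Lemma cvg_mulmx (R : realType) (T : Type) (G : set_system T) {FG : Filter G} m d q
    (M : 'M[R]_(m, d)) (u : T -> 'M[R]_(d, q)) (l : 'M[R]_(d, q)) :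
  u t @[t --> G] --> l -> M *m u t @[t --> G] --> M *m l.
Proof.
move=> /cvg_mxP ul; apply/cvg_mxP => i j; rewrite mxE.
under eq_fun do rewrite mxE.
by apply: cvg_sumr => k _; apply: cvgMl_tmp; exact: ul.
Qed.

Lemma convex_functionP (R : realType) (V : lmodType R) (S : set V) (h : V -> R)
    (x z : V) (t : R) : convex_function (E:=V) S h -> S x -> S z -> 0 <= t <= 1 ->
  h (t *: z + (1 - t) *: x) <= t * h z + (1 - t) * h x.
Proof.
move=> hS Sx Sz /andP[t0 t1].
by have := hS (Itv01 t0 t1) z x; rewrite !inE; apply.
Qed.

(** Fréchet differentiability over a full neighbourhood of [x], whereas [derivative_on] only tests
    points of the set. *)
Definition has_gradient (R : realType) d (h : 'cV[R]_d -> R) (J : 'rV[R]_d)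
    (x : 'cV[R]_d) : Prop :=
  forall eps : R, 0 < eps ->
    \forall z \near x, `|h z - h x - (J *m (z - x)) 0 0| <= eps * `|z - x|.

Lemma derivative_on_gradient (R : realType) d (S : set 'cV[R]_d)
    (h : 'cV[R]_d -> R) (J : 'rV[R]_d) x : (\forall z \near x, S z) ->
  derivative_on S (fun z => (h z)%:M : 'cV[R]_1) J x -> has_gradient h J x.
Proof.
move=> nS hJ eps eps0; have hJx : \forall z \near x, S z -> _ := hJ eps eps0.
apply: filterS (filterI hJx nS) => z [/[apply] hz]; apply: le_trans hz.
by apply: le_trans (ler_mx_norm _ 0 0); rewrite !mxE /= !mulr1n.
Qed.

(** With [eps = 1] the increment of [h] lies within [|u t - x|] of a linear term that tends to 0.
    The filter is arbitrary so that continuity applies along ultrafilters and along the filters of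
    [measurable_initial_open]. *)
Lemma has_gradient_cvg (R : realType) (T : Type) (G : set_system T)
    {FG : Filter G} d (h : 'cV[R]_d -> R) J (u : T -> 'cV[R]_d) x :
  has_gradient h J x -> u t @[t --> G] --> x -> h (u t) @[t --> G] --> h x.
Proof.
move=> hJ ux.
have zx : u t - x @[t --> G] --> (0 : 'cV[R]_d) by apply/subr_cvg0.
have Jx : (J *m (u t - x)) 0 0 @[t --> G] --> (0 : R).
  have -> : (0 : R) = (J *m (0 : 'cV[R]_d)) 0 0 by rewrite mulmx0 mxE.
  by have /cvg_mxP := cvg_mulmx (FG := FG) (M := J) zx; exact.
have nx : `|u t - x| @[t --> G] --> (0 : R).
  by rewrite -[X in _ --> X](normr0 'cV[R]_d); exact: cvg_norm.
have Jn : (J *m (u t - x)) 0 0 - `|u t - x| @[t --> G] --> (0 : R).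
  by rewrite -[X in _ --> X](subr0 (0 : R)); exact: cvgB.
have Jp : (J *m (u t - x)) 0 0 + `|u t - x| @[t --> G] --> (0 : R).
  by rewrite -[X in _ --> X](addr0 (0 : R)); exact: cvgD.
apply/subr_cvg0; apply: squeeze_cvgr Jn Jp.
have := ux _ (hJ 1 ltr01); apply: (@filterS _ G) => t /=.
by rewrite mul1r ler_norml => /andP[? ?]; apply/andP; split; lra.
Qed.

Lemma has_gradient_dir (R : realType) d (h : 'cV[R]_d -> R) J x (v : 'cV[R]_d) :
  has_gradient h J x ->
  t^-1 * (h (x + t *: v) - h x) @[t --> 0^'+] --> (J *m v) 0 0.
Proof.
move=> hJ.
have xt : x + t *: v @[t --> (0 : R)^'+] --> x.
  apply: cvg_at_right_filter.
  rewrite -[X in _ --> X]addr0 -[X in _ + X](scale0r v).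
  by apply: cvgD; [exact: cvg_cst|exact: cvgZr_tmp].
apply/cvgrPdist_le => eps eps0.
(* The added 1 keeps the divisor positive when [v = 0]. *)
have e0 : 0 < eps / (`|v| + 1) by rewrite divr_gt0// ltr_wpDl.
near=> t.
have t0 : 0 < t by near: t; exact: nbhs_right_gt.
have : `|h (x + t *: v) - h x - (J *m (x + t *: v - x)) 0 0| <=
       eps / (`|v| + 1) * `|x + t *: v - x|.
  by near: t; exact: (xt _ (hJ _ e0)).
rewrite (_ : x + t *: v - x = t *: v); last by rewrite addrAC subrr add0r.
rewrite -scalemxAr mxE normrZ (gtr0_norm t0) => ht.
have -> : (J *m v) 0 0 - t^-1 * (h (x + t *: v) - h x) =
  - (t^-1 * (h (x + t *: v) - h x - t * (J *m v) 0 0)) by field; rewrite gt_eqF.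
rewrite normrN normrM gtr0_norm ?invr_gt0// mulrC ler_pdivrMr//.
apply: le_trans ht _; rewrite [t * _]mulrC mulrA ler_pM2r//.
rewrite mulrAC ler_pdivrMr ?ltr_wpDl//.
by rewrite ler_pM2l// lerDl.
Unshelve. all: by end_near. Qed.

(** Gradient and supporting inequality are bundled because both pass to sums and positive multiples,
    hence from [f] and the barriers to [F]. *)
Definition subgradient (R : realType) d (S : set 'cV[R]_d) (h : 'cV[R]_d -> R)
    (J : 'rV[R]_d) (x : 'cV[R]_d) : Prop :=
  has_gradient h J x /\ forall z, S z -> h x + (J *m (z - x)) 0 0 <= h z.

(** By convexity the difference quotients towards [z] are at most [h z - h x] for 0 < t <= 1; as t
    tends to 0 they converge to the directional derivative. *)
Lemma convex_gradient_subgradient (R : realType) d (S : set 'cV[R]_d)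
    (h : 'cV[R]_d -> R) J x :
  convex_function (E:='cV[R]_d) S h -> S x -> has_gradient h J x ->
  subgradient S h J x.
Proof.
move=> hS Sx hJ; split=> // z Sz; rewrite -lerBrDl.
apply: (cvgr_to_le (@has_gradient_dir _ _ _ _ _ (z - x) hJ)).
near=> t.
have t0 : 0 < t by near: t; exact: nbhs_right_gt.
have t1 : t <= 1 by near: t; exact: nbhs_right_le.
rewrite mulrC ler_pdivrMr//.
have -> : x + t *: (z - x) = t *: z + (1 - t) *: x.
  by rewrite scalerBr scalerBl scale1r addrCA addrA.
have /(_ _)/le_trans := @convex_functionP _ _ _ _ x z t hS Sx Sz.
rewrite (ltW t0) t1 => /(_ _ isT).
have := @convex_functionP _ _ _ _ x z t hS Sx Sz; rewrite (ltW t0) t1 => /(_ isT).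
by lra.
Unshelve. all: by end_near. Qed.

Lemma subgradientD (R : realType) d (S : set 'cV[R]_d) (h k : 'cV[R]_d -> R)
    J K x : subgradient S h J x -> subgradient S k K x ->
  subgradient S (fun z => h z + k z) (J + K) x.
Proof.
move=> [hJ hS] [kK kS]; split=> [eps eps0|z Sz]; last first.
  rewrite mulmxDl mxE; have := hS z Sz; have := kS z Sz; lra.
have e2 : 0 < eps / 2 by rewrite divr_gt0.
near=> z.
have hz : `|h z - h x - (J *m (z - x)) 0 0| <= eps / 2 * `|z - x|.
  by near: z; exact: hJ.
have kz : `|k z - k x - (K *m (z - x)) 0 0| <= eps / 2 * `|z - x|.
  by near: z; exact: kK.
rewrite mulmxDl mxE.
have -> : forall a b c d e f : R, a + b - (c + d) - (e + f) = (a - c - e) + (b - d - f).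
  by move=> *; ring.
by apply: le_trans (ler_normD _ _) _; lra.
Unshelve. all: by end_near. Qed.

Lemma subgradientZ (R : realType) d (S : set 'cV[R]_d) (h : 'cV[R]_d -> R)
    J x (c : R) : 0 < c -> subgradient S h J x ->
  subgradient S (fun z => c * h z) (c *: J) x.
Proof.
move=> c0 [hJ hS]; split=> [eps eps0|z Sz]; last first.
  by rewrite -scalemxAl mxE -mulrDr ler_pM2l// hS.
have e2 : 0 < eps / c by rewrite divr_gt0.
near=> z.
have hz : `|h z - h x - (J *m (z - x)) 0 0| <= eps / c * `|z - x|.
  by near: z; exact: hJ.
rewrite -scalemxAl mxE -!mulrBr normrM gtr0_norm//.
by rewrite mulrC -ler_pdivlMr// mulrAC.
Unshelve. all: by end_near. Qed.

Lemma subgradient0 (R : realType) d (S : set 'cV[R]_d) x :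
  subgradient S (fun=> 0) 0 x.
Proof.
split=> [eps eps0|z _]; last by rewrite mul0mx mxE addr0.
by apply: (@nearW _ _ _ (nbhs_filter x)) => z;
  rewrite mul0mx mxE !subr0 normr0 mulr_ge0// ltW.
Qed.

Lemma subgradient_sum (R : realType) d (S : set 'cV[R]_d) (I : Type) (r : seq I)
    (h : I -> 'cV[R]_d -> R) (J : I -> 'rV[R]_d) x :
  (forall i, subgradient S (h i) (J i) x) ->
  subgradient S (fun z => \sum_(i <- r) h i z) (\sum_(i <- r) J i) x.
Proof.
move=> hJ; elim: r => [|i r IH].
  by rewrite big_nil; under eq_fun do rewrite big_nil; exact: subgradient0.
by rewrite big_cons; under eq_fun do rewrite big_cons; exact: subgradientD.
Qed.

(** * Stationary states are optimal *)

Section Problem.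
Variables (R : realType) (n : nat) (e : rel 'I_n) (Q : problem R n).

(* The cone R_+^m_in x {0}: every feasibility condition says that a surplus of
   resources (available minus used) lies in it. *)
Definition slack (s : 'cV[R]_(m_in Q + m_eq Q)) : Prop :=
  lev 0 (usubmx s) /\ dsubmx s = 0.

Lemma slack0 : slack 0.
Proof. by split=> [r|]; rewrite linear0// mxE. Qed.

Lemma slackD s t : slack s -> slack t -> slack (s + t).
Proof.
move=> [s0 sE] [t0 tE]; split; last by rewrite linearD/= sE tE addr0.
by move=> r; rewrite linearD/= mxE [leRHS]mxE addr_ge0//;
  [have := s0 r|have := t0 r]; rewrite mxE.
Qed.

Lemma slackZ (a : R) s : 0 <= a -> slack s -> slack (a *: s).
Proof.
move=> a0 [s0 sE]; split; last by rewrite linearZ/= sE scaler0.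
by move=> r; rewrite linearZ/= mxE [leRHS]mxE mulr_ge0//; have := s0 r; rewrite mxE.
Qed.

Lemma slack_sum (I : Type) (r : seq I) (p : pred I) (s : I -> 'cV_(m_in Q + m_eq Q)) :
  (forall i, p i -> slack (s i)) -> slack (\sum_(i <- r | p i) s i).
Proof. by move=> ps; apply: big_ind => //; [exact: slack0|exact: slackD]. Qed.

Lemma slack_col_mx (u : 'cV[R]_(m_in Q)) (v : 'cV[R]_(m_eq Q)) u' v' :
  slack (col_mx u v - col_mx u' v') <-> lev u' u /\ v' = v.
Proof.
rewrite /slack opp_col_mx add_col_mx col_mxKu col_mxKd; split=> -[uu vv]; split.
- by move=> r; have := uu r; rewrite !mxE subr_ge0.
- by apply/eqP; rewrite eq_sym -subr_eq0 vv.
- by move=> r; have := uu r; rewrite !mxE subr_ge0.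
- by rewrite vv subrr.
Qed.

Lemma feasibleS_slack i y x :
  feasibleS Q i y x <-> Xt Q i x /\ slack (y - A Q i *m x).
Proof.
have -> : y - A Q i *m x = col_mx (usubmx y) (dsubmx y) -
    col_mx (Ain Q i *m x) (Aeq Q i *m x) by rewrite vsubmxK -mul_col_mx.
rewrite slack_col_mx.
by split=> [[? ? ?]|[? []]].
Qed.

Lemma coupling_slack (z : profile Q) :
  coupling z <-> slack (b Q - \sum_i A Q i *m z i).
Proof.
have -> : \sum_i A Q i *m z i =
    col_mx (\sum_i Ain Q i *m z i) (\sum_i Aeq Q i *m z i).
  rewrite -[LHS]vsubmxK !linear_sum /=; congr col_mx; apply: eq_bigr => i _;
  by rewrite mul_col_mx ?col_mxKu ?col_mxKd.
by rewrite slack_col_mx.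
Qed.

Lemma feasible_block_slack i (y : alloc Q) (z : profile Q) :
  feasible_block e i y z <-> (forall j, j \in cnbr e i -> Xt Q j (z j)) /\
    slack (\sum_(j in cnbr e i) (y j - A Q j *m z j)).
Proof.
have -> : \sum_(j in cnbr e i) (y j - A Q j *m z j) =
    col_mx (\sum_(j in cnbr e i) usubmx (y j)) (\sum_(j in cnbr e i) dsubmx (y j)) -
    col_mx (\sum_(j in cnbr e i) Ain Q j *m z j) (\sum_(j in cnbr e i) Aeq Q j *m z j).
  rewrite opp_col_mx add_col_mx -!sumrB -[LHS]vsubmxK !linear_sum /=.
  congr col_mx; apply: eq_bigr => j _;
  by rewrite linearB /= mul_col_mx ?col_mxKu ?col_mxKd.
rewrite slack_col_mx; split=> [[? ? ?]|[? []]] //; split=> //; split.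
Qed.

(** What DRRA preserves: local feasibility and the total resource. Optimality of [x i] for (S) is
    not included, so the class is closed enough for limits. *)
Definition invariant (x : profile Q) (y : alloc Q) : Prop :=
  (forall i, Xt Q i (x i) /\ slack (y i - A Q i *m x i)) /\ \sum_i y i = b Q.

Lemma invariant_feasibleB x y : invariant x y -> feasibleB Q x.
Proof.
move=> [xy yb]; split=> [i|]; first by have [] := xy i.
apply/coupling_slack; rewrite -yb -sumrB; apply: slack_sum => i _.
by have [] := xy i.
Qed.

Lemma feasibleB_P x : feasibleB Q x -> feasibleP Q x.
Proof. by move=> [xt xc]; split=> // i j; apply: ltW; exact: xt. Qed.

Lemma invariant_feasible_block x y i : invariant x y -> feasible_block e i y x.
Proof.
move=> [xy _]; apply/feasible_block_slack; split=> [j _|]; first by have [] := xy j.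
by apply: slack_sum => j _; have [] := xy j.
Qed.

Variable (B : barriers Q).
Hypotheses (B_barrier : is_barrier B)
  (f_smooth_convex : forall i,
      convex_function (X Q i) (f Q i) /\ C2_on (X Q i) (f Q i))
  (g_smooth_convex : forall i (j : 'I_(ncon Q i)),
      convex_function setT (g Q i j) /\ C2_on setT (g Q i j))
  (A_full_row_rank : forall i, \rank (A Q i) = (m_in Q + m_eq Q)%N).

(** * Regularity of the constraints, the barriers and the local costs *)

Lemma g_gradient i j x : exists J, has_gradient (g Q i j) J x.
Proof.
have [_ [J [H [gJ _ _]]]] := g_smooth_convex j.
exists (J x); apply: derivative_on_gradient (gJ x _) => //.
exact: (@nearW _ _ _ (nbhs_filter x)).
Qed.

Lemma g_cvg (T : Type) (G : set_system T) {FG : Filter G} i j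
    (u : T -> 'cV_(xdim Q i)) x :
  u t @[t --> G] --> x -> g Q i j (u t) @[t --> G] --> g Q i j x.
Proof. by have [J gJ] := g_gradient j x; exact: (has_gradient_cvg gJ). Qed.

Lemma Xt_near (T : Type) (G : set_system T) {FG : Filter G} i
    (u : T -> 'cV_(xdim Q i)) x :
  u t @[t --> G] --> x -> Xt Q i x -> \forall t \near G, Xt Q i (u t).
Proof.
move=> ux Xx; apply: (@filter_forall _ _ (fun j t => g Q i j (u t) < 0) G _) => j.
exact: (cvgr_lt _ (g_cvg (j := j) ux) _ (Xx j)).
Qed.

(** The derivative of [f] is relative to the closed set [X], so a full gradient is obtained at
    points of [Xt], which are interior; the supporting inequality still covers all of [X]. *)
Lemma f_subgradient i x : Xt Q i x -> exists J, subgradient (X Q i) (f Q i) J x.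
Proof.
move=> Xx; have [fc [J [H [fJ _ _]]]] := f_smooth_convex i.
have XX : X Q i x by move=> j; apply: ltW; exact: Xx.
exists (J x); apply: convex_gradient_subgradient => //.
apply: derivative_on_gradient (fJ x _) => //.
have := @Xt_near _ _ (nbhs_filter x) i id x cvg_id Xx.
by apply: (@filterS _ _ (nbhs_filter x)) => z Xz j; apply: ltW; exact: Xz.
Qed.

Lemma B_subgradient i (j : 'I_(ncon Q i)) x : Xt Q i x ->
  exists J, subgradient (Xt Q i) (B j) J x.
Proof.
move=> Xx; have [_ Bc [J [H [BJ _ _]]]] := B_barrier j.
exists (J x); apply: convex_gradient_subgradient => //.
apply: derivative_on_gradient (BJ x _) => //.
exact: (@Xt_near _ _ (nbhs_filter x) i id x cvg_id Xx).
Qed.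

Variable (c : R).
Hypothesis (c0 : 0 < c).

Lemma F_subgradient i x : Xt Q i x ->
  exists J, subgradient (Xt Q i) (F B c i) J x.
Proof.
move=> Xx; have [J [fJ fX]] := f_subgradient Xx.
have /choice[K BK] := fun j => B_subgradient j Xx.
exists (J + c *: \sum_j K j); apply: subgradientD.
  by split=> // z Xz; apply: fX => j; apply: ltW; exact: Xz.
by apply: subgradientZ => //; exact: subgradient_sum.
Qed.

Lemma F_cvg (T : Type) (G : set_system T) {FG : Filter G} i
    (u : T -> 'cV_(xdim Q i)) x : Xt Q i x ->
  u t @[t --> G] --> x -> F B c i (u t) @[t --> G] --> F B c i x.
Proof. by move=> /F_subgradient[J [FJ _]]; exact: (has_gradient_cvg FJ). Qed.

(** The strict inequality makes gaining an open condition; for [delta = 0] it says that [x] is not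
    optimal in block [i]. *)
Definition gain i (delta : R) (x : profile Q) (y : alloc Q) : Prop :=
  exists2 z, feasible_block e i y z &
    block_cost B c e i z + delta < block_cost B c e i x.

Lemma mulA_pinv i (v : 'cV_(m_in Q + m_eq Q)) : A Q i *m (pinvmx (A Q i) *m v) = v.
Proof. by rewrite mulmxA mulmxVp ?mul1mx// /row_free A_full_row_rank. Qed.

(* Full row rank lets a block-feasible point follow a change of the allocation. *)
Lemma gain_near (T : Type) (G : set_system T) {FG : Filter G}
    (x : T -> profile Q) (y : T -> alloc Q) xb yb i delta :
  (forall j, Xt Q j (xb j)) ->
  (forall j, x t j @[t --> G] --> xb j) -> (forall j, y t j @[t --> G] --> yb j) ->
  gain i delta xb yb -> \forall t \near G, gain i delta (x t) (y t).
Proof.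
move=> Xxb xxb yyb [z /feasible_block_slack[Xz sz] ltz].
(* The correction changes the use of node [j] by exactly [y t j - yb j], so the residuals of [z] are
   unchanged. *)
pose w t : profile Q := fun j => z j + pinvmx (A Q j) *m (y t j - yb j).
have wz j : w t j @[t --> G] --> z j.
  rewrite -[X in _ --> X]addr0; apply: cvgD; first exact: cvg_cst.
  rewrite -[X in _ --> X](mulmx0 _ (pinvmx (A Q j))); apply: cvg_mulmx.
  by apply/subr_cvg0.
have costw : block_cost B c e i (w t) @[t --> G] --> block_cost B c e i z.
  by apply: cvg_sumr => j ji; apply: F_cvg => //; exact: Xz.
have costx : block_cost B c e i (x t) @[t --> G] --> block_cost B c e i xb.
  by apply: cvg_sumr => j ji; apply: F_cvg.
have Xw : \forall t \near G, forall j : 'I_n, j \in cnbr e i -> Xt Q j (w t j).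
  apply: (@filter_forall _ _ (fun j t => j \in cnbr e i -> Xt Q j (w t j)) G _) => j.
  have [ji|] := boolP (j \in cnbr e i); last by move=> _; exact: nearW.
  have : \forall t \near G, Xt Q j (w t j) by exact: Xt_near (wz j) (Xz j ji).
  exact: filterS.
have ltw : \forall t \near G,
    delta < block_cost B c e i (x t) - block_cost B c e i (w t).
  by apply: (cvgr_gt _ (cvgB costx costw)); rewrite ltrBrDl.
near=> t; exists (w t); last by rewrite -ltrBrDl; near: t.
apply/feasible_block_slack; split; first by near: t.
rewrite (_ : \sum_(j in _) _ = \sum_(j in cnbr e i) (yb j - A Q j *m z j))//.
apply: eq_bigr => j _; rewrite mulmxDr mulA_pinv opprD addrCA opprB.
by rewrite [X in _ + X]addrC subrK addrC.
Unshelve. all: by end_near. Qed.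

(** * First-order conditions and multipliers *)

Section Stationary.
Variables (x : profile Q) (y : alloc Q) (J : forall i, 'rV[R]_(xdim Q i)).
Hypotheses (xy : invariant x y) (no_gain : forall i, ~ gain i 0 x y)
  (FJ : forall i, has_gradient (F B c i) (J i) (x i)).

(** The residual at [x + t d] is a convex combination of those at [x] and [x + d], and small t
    preserve the strict constraints. Hence [x + t d] is a competitor, and the absence of gain makes
    the difference quotients nonnegative. *)
Lemma stationary_block i (d : profile Q) :
  slack (\sum_(j in cnbr e i) (y j - A Q j *m (x j + d j))) ->
  0 <= \sum_(j in cnbr e i) (J j *m d j) 0 0.
Proof.
move=> sd; have [Xx sx] := (feasible_block_slack i y x).1
  (invariant_feasible_block i xy).
have lim : \sum_(j in cnbr e i) t^-1 * (F B c j (x j + t *: d j) - F B c j (x j))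
    @[t --> 0^'+] --> \sum_(j in cnbr e i) (J j *m d j) 0 0.
  by apply: cvg_sumr => j _; exact: has_gradient_dir.
apply: (cvgr_to_ge lim).
have Xd : \forall t \near (0 : R)^'+,
    forall j : 'I_n, j \in cnbr e i -> Xt Q j (x j + t *: d j).
  apply: (@filter_forall _ _
    (fun j t => j \in cnbr e i -> Xt Q j (x j + t *: d j)) _ _) => j.
  have [ji|] := boolP (j \in cnbr e i); last by move=> _; exact: nearW.
  suff xd : x j + t *: d j @[t --> (0 : R)^'+] --> x j.
    have : \forall t \near (0 : R)^'+, Xt Q j (x j + t *: d j).
      exact: Xt_near xd (Xx j ji).
    exact: filterS.
  apply: cvg_at_right_filter.
  rewrite -[X in _ --> X]addr0 -[X in _ + X](scale0r (d j)).
  by apply: cvgD; [exact: cvg_cst|exact: cvgZr_tmp].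
near=> t.
have t0 : 0 < t by near: t; exact: nbhs_right_gt.
have t1 : t <= 1 by near: t; exact: nbhs_right_le.
rewrite -mulr_sumr mulr_ge0 ?invr_ge0 ?(ltW t0)// sumrB subr_ge0 leNgt.
apply/negP => lt; apply: (no_gain (i := i)).
exists (fun j => x j + t *: d j); last by rewrite addr0.
apply/feasible_block_slack; split; first by near: t.
rewrite (_ : \sum_(j in _) _ =
  (1 - t) *: \sum_(j in cnbr e i) (y j - A Q j *m x j) +
  t *: \sum_(j in cnbr e i) (y j - A Q j *m (x j + d j))).
  by apply: slackD; apply: slackZ; rewrite ?subr_ge0// ltW.
rewrite !scaler_sumr -big_split; apply: eq_bigr => j _ /=.
rewrite !mulmxDr -scalemxAr !opprD !scalerDr !scalerBl !scalerN !scale1r !addrA.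
apply/matrixP => r s; rewrite !mxE; ring.
Unshelve. all: by end_near. Qed.

(** Candidate multiplier of node [i]: the rate at which its cost grows with its use of resources.
    [stationary_range] shows that [J i = mu i *m A Q i]. *)
Let mu i : 'rV[R]_(m_in Q + m_eq Q) := J i *m pinvmx (A Q i).

Lemma in_cnbr i : i \in cnbr e i. Proof. by rewrite /cnbr in_setU1 eqxx. Qed.

(** Node [i] moves alone and uses [v] more. Taking v = -k with k in the cone gives the sign
    condition mu_i k <= 0, and taking v equal to the local slack then gives complementary
    slackness. *)
Lemma stationary_node i (v : 'cV_(m_in Q + m_eq Q)) :
  slack (y i - A Q i *m x i - v) -> 0 <= (mu i *m v) 0 0.
Proof.
move=> sv.
have -> : (mu i *m v) 0 0 =
    \sum_(j in cnbr e i) (J j *m ((j == i)%:R *: (pinvmx (A Q j) *m v))) 0 0.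
  rewrite (bigD1 i) ?in_cnbr//= eqxx scale1r mulmxA big1 ?addr0// => j /andP[_ /negPf->].
  by rewrite scale0r mulmx0 mxE.
apply: stationary_block.
have -> : \sum_(j in cnbr e i)
     (y j - A Q j *m (x j + (j == i)%:R *: (pinvmx (A Q j) *m v))) =
    \sum_(j in cnbr e i | j != i) (y j - A Q j *m x j) + (y i - A Q i *m x i - v).
  rewrite (bigD1 i) ?in_cnbr//= eqxx scale1r mulmxDr mulA_pinv opprD addrA addrC.
  congr (_ + _); apply: eq_bigr => j /andP[_ /negPf->].
  by rewrite scale0r addr0.
by apply: slackD => //; apply: slack_sum => j _; have [] := xy.1 j.
Qed.

(** The two hypotheses together say that the use of the block does not change, so both [d] and [- d]
    are admissible directions. *)
Lemma stationary_null i (d : profile Q) :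
  slack (\sum_(j in cnbr e i) A Q j *m d j) ->
  slack (- \sum_(j in cnbr e i) A Q j *m d j) ->
  \sum_(j in cnbr e i) (J j *m d j) 0 0 = 0.
Proof.
have [_ sx] := (feasible_block_slack i y x).1 (invariant_feasible_block i xy).
have dE (d' : profile Q) : \sum_(j in cnbr e i) (y j - A Q j *m (x j + d' j)) =
    \sum_(j in cnbr e i) (y j - A Q j *m x j) - \sum_(j in cnbr e i) A Q j *m d' j.
  by rewrite -sumrB; apply: eq_bigr => j _; rewrite mulmxDr opprD addrA.
move=> dp dn; apply/eqP; rewrite eq_le; apply/andP; split.
  rewrite -oppr_ge0 -sumrN.
  rewrite (eq_bigr (fun j => (J j *m (- d j)) 0 0)); last first.
    by move=> j _; rewrite mulmxN [RHS]mxE.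
  apply: (stationary_block (d := fun j => - d j)); rewrite dE; apply: slackD => //.
  by rewrite -sumrN; under eq_bigr do rewrite mulmxN opprK.
by apply: stationary_block; rewrite dE; exact: slackD.
Qed.

(** Moving node [i] along the component of [d i] in the kernel of [A Q i] does not change resource
    use, so [J i] vanishes on it. *)
Lemma stationary_range i (d : profile Q) :
  (J i *m d i) 0 0 = (mu i *m (A Q i *m d i)) 0 0.
Proof.
pose w : profile Q := fun j =>
  (j == i)%:R *: (d j - pinvmx (A Q j) *m (A Q j *m d j)).
have Aw : \sum_(j in cnbr e i) A Q j *m w j = 0.
  rewrite big1// => j _; rewrite /w -scalemxAr mulmxBr mulA_pinv subrr scaler0//.
have := @stationary_null i w; rewrite Aw oppr0 => /(_ slack0 slack0).
rewrite (bigD1 i) ?in_cnbr//= big1; last first.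
  by move=> j /andP[_ /negPf ji]; rewrite /w ji scale0r mulmx0 mxE.
rewrite addr0 /w eqxx scale1r mulmxBr mxE [X in _ + X]mxE => H0.
by apply: subr0_eq; rewrite mulmxA in H0.
Qed.

(** Transferring [v] from [j] to [i] stays inside the block of [i] and has zero net use, so the two
    prices of [v] agree. *)
Lemma stationary_edge i j (v : 'cV_(m_in Q + m_eq Q)) : e i j -> irreflexive e ->
  (mu i *m v) 0 0 = (mu j *m v) 0 0.
Proof.
move=> ij ei; have ji : (j == i) = false.
  by apply/negbTE/eqP => ji; rewrite ji ei in ij.
have jN : j \in cnbr e i by rewrite /cnbr /nbr in_setU1 inE ij orbT.
pose w : profile Q := fun k => ((k == i)%:R - (k == j)%:R) *: (pinvmx (A Q k) *m v).
have sumw (q : forall k, 'rV[R]_(xdim Q k)) :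
    \sum_(k in cnbr e i) (q k *m w k) 0 0 =
    (q i *m pinvmx (A Q i) *m v) 0 0 - (q j *m pinvmx (A Q j) *m v) 0 0.
  rewrite (bigD1 i) ?in_cnbr//= (bigD1 j) ?jN ?ji//= big1; last first.
    move=> k /andP[/andP[_ /negPf ki] /negPf kj].
    by rewrite /w ki kj subrr scale0r mulmx0 mxE.
  rewrite addr0 /w !eqxx ji eq_sym ji subr0 sub0r scale1r scaleN1r.
  by rewrite mulmxN [X in _ + X]mxE !mulmxA.
have Aw : \sum_(k in cnbr e i) A Q k *m w k = 0.
  rewrite (eq_bigr (fun k => ((k == i)%:R - (k == j)%:R) *: v)); last first.
    by move=> k _; rewrite -scalemxAr mulA_pinv.
  rewrite (bigD1 i) ?in_cnbr//= (bigD1 j) ?jN ?ji//= big1; last first.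
    by move=> k /andP[/andP[_ /negPf ki] /negPf kj]; rewrite ki kj subrr scale0r.
  by rewrite addr0 !eqxx eq_sym ji subr0 sub0r scale1r scaleN1r subrr.
have := @stationary_null i w; rewrite Aw oppr0 => /(_ slack0 slack0)/eqP.
by rewrite sumw subr_eq0 => /eqP.
Qed.

Lemma stationary_multiplier i j (v : 'cV_(m_in Q + m_eq Q)) : connected_graph e ->
  (mu i *m v) 0 0 = (mu j *m v) 0 0.
Proof.
move=> [_ ei /(_ i j)/connectP[p + ->]]; elim: p i => //= k p IH i /andP[ik kp].
by rewrite (stationary_edge v ik ei); exact: IH.
Qed.

(* With s_j >= 0 the local slacks and s >= 0 the slack of z, the common
   multiplier is nonnegative on each s_j - s/n, and these add up to
   A z - A x. *)
Lemma stationary_direction (z : profile Q) : connected_graph e -> coupling z ->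
  0 <= \sum_i (J i *m (z i - x i)) 0 0.
Proof.
move=> eg /coupling_slack sz.
pose sg := b Q - \sum_i A Q i *m z i.
pose v i := y i - A Q i *m x i - n%:R^-1 *: sg.
have v0 i : 0 <= (mu i *m v i) 0 0.
  by apply: stationary_node; rewrite opprB addrC subrK; apply: slackZ; rewrite ?invr_ge0.
(* The common multiplier is read off at a reference node, which exists unless the sum is empty. *)
have [n0|n0] := posnP n.
  by rewrite big1// => -[i /= i0]; exfalso; rewrite n0 in i0.
pose i0 := Ordinal n0.
rewrite (eq_bigr (fun i => (mu i0 *m (A Q i *m (z i - x i))) 0 0)); last first.
  move=> i _; rewrite (stationary_range i (fun j => z j - x j)).
  exact: stationary_multiplier.
rewrite (_ : \sum_i _ = \sum_i (mu i0 *m v i) 0 0); last first.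
  rewrite -!summxE -!mulmx_sumr; congr ((_ *m _) _ _).
  rewrite sumrB sumr_const card_ord -scaler_nat scalerA divff ?pnatr_eq0 -?lt0n//.
  rewrite scale1r /sg sumrB xy.2 opprB addrC addrA subrK.
  by rewrite -sumrB; apply: eq_bigr => i _; rewrite mulmxBr.
apply: sumr_ge0 => i _; rewrite (stationary_multiplier i0 i)//.
Qed.
End Stationary.

Lemma no_gain_optimal (x : profile Q) (y : alloc Q) (z : profile Q) :
  connected_graph e -> invariant x y -> (forall i, ~ gain i 0 x y) ->
  feasibleB Q z -> \sum_i F B c i (x i) <= \sum_i F B c i (z i).
Proof.
move=> eg xy ng [Xz zc].
have FJ i : {J | subgradient (Xt Q i) (F B c i) J (x i)}.
  by apply: cid; apply: F_subgradient; have [] := xy.1 i.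
have := @stationary_direction x y _ xy ng (fun i => (svalP (FJ i)).1) z eg zc.
rewrite -(lerD2l (\sum_i F B c i (x i))) addr0 => /le_trans; apply.
by rewrite -big_split; apply: ler_sum => i _; apply: (svalP (FJ i)).2.
Qed.
End Problem.

(** * Uniform gain away from the optimum *)

Lemma ultra_fmap (T U : Type) (h : T -> U) (G : set_system T) :
  UltraFilter G -> UltraFilter (fmap h G).
Proof.
move=> GU; split; first exact: fmap_proper_filter.
move=> H HF GH; apply/seteqP; split=> [C|C /GH //] HC.
have [//|nC] := in_ultra_setVsetC (h @^-1` C) GU.
have /filter_ex[u [Cu]] : H (C `&` ~` C) by apply: filterI => //; exact: GH.
by [].
Qed.

Lemma ultra_bounded_cvg (R : realType) (T : Type) (G : set_system T)
    {GU : UltraFilter G} (u : T -> R) (a b : R) :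
  (\forall t \near G, a <= u t <= b) -> exists l : R, u t @[t --> G] --> (l : R).
Proof.
move=> uab; have := @segment_compact R a b; rewrite compact_ultra.
move=> /(_ (fmap u G) (ultra_fmap u GU)) [|l [_ ul]]; last by exists l.
by apply: filterS uab => t /= ut; rewrite in_itv.
Qed.

Lemma sum_le_term (R : numDomainType) (I : finType) (l a : I -> R) i :
  (forall k, l k <= a k) -> a i <= \sum_k a k - \sum_(k | k != i) l k.
Proof.
by move=> la; rewrite (bigD1 i)//= lerBrDr lerD2l; apply: ler_sum.
Qed.

Section Compactness.
Variables (R : realType) (n : nat) (e : rel 'I_n) (Q : problem R n)
  (B : barriers Q).
Hypotheses (e_graph : connected_graph e) (B_barrier : is_barrier B)
  (f_smooth_convex : forall i,
      convex_function (X Q i) (f Q i) /\ C2_on (X Q i) (f Q i))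
  (g_smooth_convex : forall i (j : 'I_(ncon Q i)),
      convex_function setT (g Q i j) /\ C2_on setT (g Q i j))
  (slater : exists xs : profile Q,
      (forall i (j : 'I_(ncon Q i)), g Q i j (xs i) < 0) /\ coupling xs)
  (P_compact :
      compact (feasibleP Q : set (prod_topology (fun i => 'cV[R]_(xdim Q i)))))
  (A_full_row_rank : forall i, \rank (A Q i) = (m_in Q + m_eq Q)%N).

Lemma cvg_coord (T : Type) (G : set_system T) {FG : Filter G}
    (x : T -> prod_topology (fun i => 'cV[R]_(xdim Q i)))
    (xb : prod_topology (fun i => 'cV[R]_(xdim Q i))) i :
  x t @[t --> G] --> xb -> x t i @[t --> G] --> xb i.
Proof.
move=> xxb.
exact: (cvg_comp _ _ xxb (@proj_continuous _ (fun i => 'cV[R]_(xdim Q i)) i xb)).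
Qed.

(** The affine minorant is continuous, hence bounded on the compact feasible set of (P). This also
    bounds barriers, which are defined only on a non-closed part of it. *)
Lemma subgradient_lbound i (S : set 'cV[R]_(xdim Q i)) h J x :
  subgradient S h J x ->
  exists L, forall z, feasibleP Q z -> S (z i) -> L <= h (z i).
Proof.
move=> [_ hJ].
pose u (z : prod_topology (fun i => 'cV[R]_(xdim Q i))) :=
  (J *m (z i - x)) 0 0.
have uc : continuous u.
  move=> z; rewrite /u.
  have zx : w i - x @[w --> z] --> z i - x.
    apply: (@cvgB _ _ _ _ (nbhs_filter z)); last exact: cvg_cst.
    exact: (@cvg_coord _ _ (nbhs_filter z) id z i cvg_id).
  by have /cvg_mxP := cvg_mulmx (FG := nbhs_filter z) (M := J) zx; exact.
have := @continuous_compact _ R u (feasibleP Q) (continuous_subspaceT uc) P_compact.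
move=> /compact_bounded[M [_ /(_ (M + 1))]].
rewrite ltrDl ltr01 => /(_ isT) Mu.
exists (h x - (M + 1)) => z Pz Sz; apply: (le_trans _ (hJ _ Sz)); rewrite lerD2l.
by have := Mu (u z); rewrite /= ler_norml => /(_ _)/andP[|//]; exists z.
Qed.

Lemma f_lbound : exists L : 'I_n -> R,
  forall i z, feasibleP Q z -> L i <= f Q i (z i).
Proof.
have [xs [Xs _]] := slater.
have /choice[L LP] i : exists L, forall z, feasibleP Q z -> L <= f Q i (z i).
  have [J fJ] := f_subgradient f_smooth_convex g_smooth_convex (Xs i).
  have [L LP] := subgradient_lbound fJ.
  by exists L => z Pz; apply: LP => //; exact: Pz.1.
by exists L => i z; exact: LP.
Qed.

Lemma B_lbound : exists L : forall i, 'I_(ncon Q i) -> R,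
  forall i j z, feasibleB Q z -> L i j <= B j (z i).
Proof.
have [xs [Xs _]] := slater.
have H i (j : 'I_(ncon Q i)) : {L | forall z, feasibleB Q z -> L <= B j (z i)}.
  apply: cid; have [J BJ] := B_subgradient B_barrier g_smooth_convex j (Xs i).
  have [L LP] := subgradient_lbound BJ.
  by exists L => z Bz; apply: LP; [exact: feasibleB_P|exact: Bz.1].
by exists (fun i j => sval (H i j)) => i j z; exact: svalP (H i j) z.
Qed.

Variable (c : R).
Hypothesis (c0 : 0 < c).

Let V (z : profile Q) := \sum_i F B c i (z i).

Lemma F_lbound : exists L : 'I_n -> R,
  forall i z, feasibleB Q z -> L i <= F B c i (z i).
Proof.
have [l lP] := f_lbound; have [m mP] := B_lbound.
exists (fun i => l i + c * \sum_j m i j) => i z Bz.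
apply: lerD; first by apply: lP; exact: feasibleB_P.
by rewrite ler_pM2l//; apply: ler_sum => j _; exact: mP.
Qed.

Lemma Fstar_fin : exists v, [/\ Fstar B c = v%:E,
  forall z, feasibleB Q z -> v <= V z &
  forall l, (forall z, feasibleB Q z -> l <= V z) -> l <= v].
Proof.
have [xs xsP] := slater; have [L LP] := F_lbound.
have lb l : (forall z, feasibleB Q z -> l <= V z) -> (l%:E <= Fstar B c)%E.
  by move=> lV; apply: le_ereal_inf_tmp => _ [z Bz <-]; rewrite lee_fin; exact: lV.
have ub z : feasibleB Q z -> (Fstar B c <= (V z)%:E)%E.
  by move=> Bz; apply: ereal_inf_lbound; exists z.
have Fin : Fstar B c \is a fin_num.
  rewrite fin_numElt (le_lt_trans (ub xs _) (ltry _))//.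
  rewrite (lt_le_trans (ltNyr (\sum_i L i)))//.
  by apply: lb => z Bz; apply: ler_sum => i _; exact: LP.
exists (fine (Fstar B c)); rewrite fineK//; split=> // [z Bz|l lV].
  by rewrite -lee_fin fineK// ub.
by rewrite -lee_fin fineK// lb.
Qed.

(** All other terms of the cost are bounded below, so a cost bound caps each single barrier, and the
    blow-up of the barrier keeps [g] uniformly negative. *)
Lemma barrier_gap (V0 : R) i (j : 'I_(ncon Q i)) : exists2 delta, 0 < delta &
  forall z, feasibleB Q z -> V z <= V0 -> g Q i j (z i) <= - delta.
Proof.
have [lf lfP] := f_lbound; have [lB lBP] := B_lbound; have [lF lFP] := F_lbound.
(* Cap on [B j]: remove from [V0] the lower bounds of the other nodes and of [f], divide by [c],
   then remove those of the other barriers of node [i]. *)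
pose K := (V0 - \sum_(k | k != i) lF k - lf i) / c - \sum_(k | k != j) lB i k.
have BK z : feasibleB Q z -> V z <= V0 -> B j (z i) <= K.
  move=> Bz Vz.
  apply: le_trans (@sum_le_term _ _ (lB i) (fun k => B k (z i)) j
    (fun k => lBP i k z Bz)) _.
  rewrite lerD2r ler_pdivlMr// mulrC lerBrDl.
  have fi : lf i <= f Q i (z i) by apply: lfP; exact: feasibleB_P.
  have := sum_le_term (l := lF) (a := fun k => F B c k (z k)) i (fun k => lFP k z Bz).
  by rewrite -/(V z) {1}/F; lra.
have [H _ _] := B_barrier j; have [delta d0 dP] := H (K + 1).
exists delta => // z Bz Vz; rewrite leNgt; apply/negP => gd.
have := le_trans (dP _ gd (Bz.1 i j)) (BK z Bz Vz).
by rewrite leNgt ltrDl ltr01.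
Qed.

(** The points [x] lie in a compact set. Allocations have no a priori bound, but [y i] is at least
    [A x i] and, by conservation, at most [b] minus the use of the other nodes. Strict feasibility
    of the limit is left to [barrier_gap]. *)
Lemma invariant_limit (T : Type) (G : set_system T) {GU : UltraFilter G}
    (x : T -> profile Q) (y : T -> alloc Q) :
  (forall t, invariant (x t) (y t)) -> exists xb : profile Q, exists yb : alloc Q,
    [/\ forall i, x t i @[t --> G] --> xb i, forall i, y t i @[t --> G] --> yb i,
        forall i, slack (yb i - A Q i *m xb i) & \sum_i yb i = b Q].
Proof.
move=> xy; move: P_compact; rewrite compact_ultra.
move=> /(_ (fmap x G) (ultra_fmap x GU)) [|xb [_ xxb']].
  by apply: nearW => t /=; apply: feasibleB_P; exact: invariant_feasibleB (xy t).
have xxb i : x t i @[t --> G] --> xb i by exact: cvg_coord xxb'.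
have Ax i r : (A Q i *m x t i) r 0 @[t --> G] --> (A Q i *m xb i) r 0.
  have /cvg_mxP : A Q i *m x t i @[t --> G] --> A Q i *m xb i by exact: cvg_mulmx.
  exact.
have Ay t i r : (A Q i *m x t i) r 0 <= y t i r 0.
  have [_] := (xy t).1 i; rewrite -{1}(vsubmxK (y t i)) mul_col_mx.
  rewrite slack_col_mx => -[le eq]; rewrite -(vsubmxK (y t i)).
  by rewrite !mxE; case: splitP => k _; [exact: le|rewrite eq].
have yyb i r : exists l : R, y t i r 0 @[t --> G] --> l.
  pose l := (A Q i *m xb i) r 0.
  pose u := b Q r 0 - \sum_(j | j != i) (A Q j *m xb j) r 0.
  (* The margins of 1 are needed because the two bounds on [y] are themselves only convergent. *)
  apply: (ultra_bounded_cvg (a := l - 1) (b := u + 1)).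
  have lA : \forall t \near G, l - 1 <= (A Q i *m x t i) r 0.
    by apply: (cvgr_ge _ (Ax i r)); rewrite ltrBlDr ltrDl.
  have uA : \forall t \near G,
      b Q r 0 - \sum_(j | j != i) (A Q j *m x t j) r 0 <= u + 1.
    have lim : b Q r 0 - \sum_(j | j != i) (A Q j *m x t j) r 0 @[t --> G] --> u.
      by apply: cvgB; [exact: cvg_cst|exact: cvg_sumr].
    by apply: (cvgr_le _ lim); rewrite ltrDl.
  near=> t; apply/andP; split; first by apply: le_trans (Ay t i r); near: t.
  apply: (@le_trans _ _ (b Q r 0 - \sum_(j | j != i) (A Q j *m x t j) r 0));
    last by near: t.
  rewrite -(xy t).2 summxE (bigD1 i)//= -addrA lerDl subr_ge0.
  by apply: ler_sum => j _; exact: Ay.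
have yb i r : {l : R | y t i r 0 @[t --> G] --> l} by exact: cid.
exists xb, (fun i => \col_r sval (yb i r)).
have ylim i : y t i @[t --> G] --> \col_r sval (yb i r).
  by apply/cvg_mxP => r k; rewrite mxE ord1; exact: svalP (yb i r).
split=> // [i|].
  have sl : y t i - A Q i *m x t i @[t --> G] -->
      \col_r sval (yb i r) - A Q i *m xb i by apply: cvgB => //; exact: cvg_mulmx.
  have sr r : (y t i - A Q i *m x t i) r 0 @[t --> G] -->
      (\col_r sval (yb i r) - A Q i *m xb i) r 0 by move/cvg_mxP : sl; exact.
  split=> [r|].
    rewrite !mxE [leRHS](_ : _ =
      (\col_r sval (yb i r) - A Q i *m xb i) (lshift _ r) 0); last by rewrite !mxE.
    apply: (cvgr_to_ge (sr (lshift _ r))); apply: nearW => t.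
    by have [_ [/(_ r)]] := (xy t).1 i; rewrite !mxE.
  apply/matrixP => r k; rewrite ord1 [RHS]mxE [LHS]mxE.
  have : (y t i - A Q i *m x t i) (rshift _ r) 0 @[t --> G] --> (0 : R).
    apply: cvg_near_cst; apply: nearW => t.
    by have [_ [_ /matrixP/(_ r 0)]] := (xy t).1 i; rewrite [LHS]mxE [RHS]mxE => ->.
  by move=> lim0; apply: (cvg_unique (@norm_hausdorff R R^o) (sr _) lim0).
have : \sum_i y t i @[t --> G] --> b Q.
  by apply: cvg_near_cst; apply: nearW => t; rewrite (xy t).2.
move=> limb; apply: (cvg_unique (@norm_hausdorff R 'cV[R]_(m_in Q + m_eq Q)) _ limb).
exact: cvg_sumr.
Unshelve. all: by end_near. Qed.

(** Otherwise some sequence of states in this cost range has no gain above 1/(m+1). Its limit is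
    strictly feasible by [barrier_gap] and has no gain, hence is optimal, against a cost of at least
    [Fs + eta]. *)
Lemma gain_uniform (Fs V0 eta : R) : 0 < eta ->
  (forall l, (forall z, feasibleB Q z -> l <= V z) -> l <= Fs) ->
  exists2 delta, 0 < delta & forall x y, invariant x y ->
    V x <= V0 -> Fs + eta <= V x -> exists i, gain e B c i delta x y.
Proof.
move=> eta0 Fsmax; apply: contrapT => noU.
have bad (m : nat) : {s : profile Q * alloc Q | [/\ invariant s.1 s.2, V s.1 <= V0,
    Fs + eta <= V s.1 & forall i, ~ gain e B c i m.+1%:R^-1 s.1 s.2]}.
  apply: cid; apply: contrapT => nos; apply: noU; exists m.+1%:R^-1.
    by rewrite invr_gt0.
  move=> x y xy Vx Fx; apply: contrapT => nog; apply: nos.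
  by exists (x, y); split=> // i gi; apply: nog; exists i.
(* An ultrafilter finer than [\oo] plays the role of a convergent subsequence. *)
have [G [GU ooG]] := @ultraFilterLemma nat \oo _.
pose x m := (sval (bad m)).1; pose y m := (sval (bad m)).2.
have sP m := svalP (bad m).
have [xb [yb [xxb yyb sb sumyb]]] := @invariant_limit _ G GU x y
  (fun m => let: And4 H _ _ _ := sP m in H).
have Xb i : Xt Q i (xb i).
  move=> j; have [delta d0 dP] := barrier_gap V0 j.
  suff : g Q i j (xb i) <= - delta by move/le_lt_trans; apply; rewrite oppr_lt0.
  apply: (cvgr_to_le (g_cvg g_smooth_convex (xxb i))).
  apply: nearW => m; have [inv Vm _ _] := sP m.
  by apply: dP => //; exact: invariant_feasibleB inv.
have inv : invariant xb yb by split.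
have ng i : ~ gain e B c i 0 xb yb.
  move=> [z zb]; rewrite addr0 -subr_gt0 => gt0.
  (* Half the gap at the limit is still gained strictly, hence also nearby, while 1/(m+1) eventually
     drops below it. *)
  pose delta := (block_cost B c e i xb - block_cost B c e i z) / 2.
  have d0 : 0 < delta by rewrite divr_gt0.
  have gd : gain e B c i delta xb yb by exists z => //; rewrite /delta; lra.
  have near_gain : \forall m \near G, gain e B c i delta (x m) (y m).
    exact: (gain_near B_barrier f_smooth_convex g_smooth_convex A_full_row_rank
      c0 Xb xxb yyb gd).
  have near_small : \forall m \near G, m.+1%:R^-1 <= delta.
    apply: ooG; have := @cvg_harmonic R => /cvgr_le; exact.
  have [m [[w wb lt] small]] := filter_ex (filterI near_gain near_small).
  have [_ _ _ /(_ i)] := sP m; apply; exists w => //.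
  by apply: le_lt_trans lt; rewrite lerD2l.
have Vb : V xb <= Fs.
  apply: Fsmax => z; exact: (no_gain_optimal B_barrier f_smooth_convex
    g_smooth_convex A_full_row_rank c0 e_graph inv ng).
have VV : V (x m) @[m --> G] --> V xb.
  by apply: cvg_sumr => i _; apply: F_cvg.
have : Fs + eta <= V xb.
  by apply: (cvgr_to_ge VV); apply: nearW => m; have [] := sP m.
by move=> /le_trans/(_ Vb); rewrite gerDl leNgt eta0.
Qed.

End Compactness.

(** * Deterministic properties of a run *)

Section Algorithm.
Variables (R : realType) (n : nat) (e : rel 'I_n) (Q : problem R n)
  (B : barriers Q) (c : R) (y0 : alloc Q) (U : nat -> {set 'I_n})
  (x : nat -> profile Q) (y : nat -> alloc Q).
Hypotheses (e_graph : connected_graph e) (y0_feasible : feasibleY B c y0)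
  (run : DRRA B c e y0 U x y).

(** Selected blocks are disjoint, so every node is either idle or counted in exactly one block. *)
Lemma sum_blocks (V : nmodType) (D : 'I_n -> V) k :
  (forall j, (forall i, i \in U k -> j \notin cnbr e i) -> D j = 0) ->
  \sum_j D j = \sum_(i in U k) \sum_(j in cnbr e i) D j.
Proof.
move=> D0; rewrite (exchange_big_dep predT)//=; apply: eq_bigr => j _.
have [[i /andP[iU ji]]|no] := pselect (exists i, (i \in U k) && (j \in cnbr e i)).
  rewrite (bigD1 i)/= ?iU// big1 ?addr0// => l /andP[/andP[lU jl] li].
  by rewrite (disjointFr (U_disjoint run lU iU li) jl) in ji.
rewrite D0 => [|i iU]; last by apply/negP => ji; apply: no; exists i; apply/andP.
by rewrite big1// => i iUji; case: no; exists i.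
Qed.

Lemma card_cnbr i : #|cnbr e i| = #|nbr e i|.+1.
Proof. by rewrite /cnbr cardsU1 inE; case: e_graph => _ -> _. Qed.

(** Block feasibility makes the equality part of the residual vanish, so both parts of the update
    follow one rule: own use plus an equal share of the block residual. *)
Lemma y_stepE k i j : i \in U k -> j \in cnbr e i ->
  y k.+1 j = A Q j *m x k.+1 j +
    (#|cnbr e i|%:R)^-1 *: \sum_(l in cnbr e i) (y k l - A Q l *m x k.+1 l).
Proof.
move=> iU ji; rewrite (y_step run iU ji) card_cnbr.
have [/feasible_block_slack[_ [_ ds]] _] := x_step run iU.
have -> : \sum_(l in cnbr e i) (y k l - A Q l *m x k.+1 l) =
    col_mx (\sum_(l in cnbr e i) (usubmx (y k l) - Ain Q l *m x k.+1 l)) 0.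
  rewrite -[LHS]vsubmxK ds linear_sum; congr col_mx; apply: eq_bigr => l _.
  by rewrite linearB /= mul_col_mx col_mxKu.
by rewrite scale_col_mx scaler0 mul_col_mx add_col_mx addr0.
Qed.

(** The new local residuals are equal shares of a block residual in the cone, and they add up to it,
    so each block keeps its total resource. *)
Lemma invariant_run k : invariant (x k) (y k).
Proof.
elim: k => [|k IH].
  split; last by rewrite (y_init run); case: y0_feasible.
  by move=> i; apply/feasibleS_slack; have [] := x_init run i.
split=> [j|].
  have [[i /andP[iU ji]]|no] := pselect (exists i, (i \in U k) && (j \in cnbr e i)).
    have [/feasible_block_slack[Xx sx] _] := x_step run iU.
    split; first exact: Xx.
    by rewrite (y_stepE iU ji) addrC addKr; apply: slackZ; rewrite ?invr_ge0.
  have [|-> ->] := xy_idle run (k := k) (i := j); last exact: IH.1.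
  by move=> i iU; apply/negP => ji; apply: no; exists i; apply/andP.
rewrite -IH.2; apply/eqP; rewrite -subr_eq0 -sumrB (@sum_blocks _ _ k); last first.
  by move=> j /(xy_idle run)[_ ->]; rewrite subrr.
rewrite big1// => i iU; rewrite sumrB (eq_bigr _ (fun j => @y_stepE k i j iU)).
rewrite big_split sumr_const -scaler_nat scalerA divff ?pnatr_eq0 ?card_cnbr//.
by rewrite scale1r sumrB [X in X - _]addrCA subrr addr0 subrr.
Qed.

Let V k := \sum_i F B c i (x k i).

Lemma cost_decrease k : V k - V k.+1 =
  \sum_(i in U k) (block_cost B c e i (x k) - block_cost B c e i (x k.+1)).
Proof.
rewrite -sumrB (@sum_blocks _ _ k); last first.
  by move=> j /(xy_idle run)[-> _]; rewrite subrr.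
by apply: eq_bigr => i _; rewrite sumrB.
Qed.

Lemma block_cost_le k i : i \in U k ->
  0 <= block_cost B c e i (x k) - block_cost B c e i (x k.+1).
Proof.
move=> iU; rewrite subr_ge0; have [_] := x_step run iU; apply.
exact: invariant_feasible_block (invariant_run k).
Qed.

Lemma cost_nonincreasing k : V k.+1 <= V k.
Proof. by rewrite -subr_ge0 cost_decrease sumr_ge0//; exact: block_cost_le. Qed.

Lemma cost_le j k : (j <= k)%N -> V k <= V j.
Proof.
move=> jk; rewrite -(subnK jk); elim: (k - j)%N => // m; apply: le_trans.
by rewrite addSn; exact: cost_nonincreasing.
Qed.

Lemma cost_gain k i delta : i \in U k -> gain e B c i delta (x k) (y k) ->
  delta <= V k - V k.+1.
Proof.
move=> iU [z zb lt]; rewrite cost_decrease (bigD1 i)//= ler_wpDr//.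
  by apply: sumr_ge0 => l /andP[lU _]; exact: block_cost_le.
rewrite lerBrDl; apply: le_trans (ltW lt); rewrite lerD2r.
by have [_] := x_step run iU; apply.
Qed.
End Algorithm.

(** * Measurability and counting of events *)

(* The hypothesis says that [O] is open for the topology induced by [h]; a union
   of boxes with rational centres then exhausts it. *)
Lemma measurable_initial_open d (T : measurableType d) (R : realType)
    (I : finType) (h : I -> T -> R) (O : set T) :
  (forall i, measurable_fun setT (h i)) ->
  (forall w, O w -> forall G : set_system T, Filter G ->
     (forall i, h i w' @[w' --> G] --> h i w) -> G O) ->
  measurable O.
Proof.
move=> mh Oopen.
pose box (q : {ffun I -> rat} * nat) : set T :=
  \bigcap_(i in [set: I]) 
      (h i @^-1` `]ratr (q.1 i) - q.2.+1%:R^-1, ratr (q.1 i) + q.2.+1%:R^-1[%classic).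
have mbox q : measurable (box q).
  apply: fin_bigcap_measurable => // i _; rewrite -[X in measurable X]setTI.
  by apply: mh => //; exact: measurable_itv.
have -> : O = \bigcup_(q : {ffun I -> rat} * nat)
    (if `[< box q `<=` O >] then box q else set0).
  apply/seteqP; split=> [w Ow|w [q _]]; last by case: asboolP => // qO /qO.
  (* The neighbourhoods of [w] in the topology induced by [h]. *)
  pose G : set_system T := filter_from [set r : R | 0 < r]
    (fun r => [set w' | forall i, `|h i w - h i w'| < r]).
  have FG : Filter G.
    apply: filter_from_filter; first by exists 1 => /=.
    move=> r s /= r0 s0; exists (Num.min r s); first by rewrite /= lt_min r0.
    by move=> w' /= ww'; split=> i; have := ww' i; rewrite lt_min => /andP[].
  have [i|r /= r0 rO] := Oopen w Ow G FG.
    by apply/cvgrPdist_lt => r r0; exists r => // w' /=; exact.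
  (* A box of radius below r/2 that contains [w] has all its points within r of [w]. *)
  have [N Nr] : exists N : nat, N.+1%:R^-1 < r / 2.
    have r2 : 0 < r / 2 by rewrite divr_gt0.
    have [N _ /(_ N) H] := cvgr_lt _ (@cvg_harmonic R) _ r2.
    by exists N; apply: H => /=.
  have N0 : 0 < N.+1%:R^-1 :> R by rewrite invr_gt0.
  have [rho rhoE] : {rho : R | rho = N.+1%:R^-1} by exists N.+1%:R^-1.
  rewrite -rhoE in Nr N0.
  have q_ex i : {q : rat | `|ratr q - h i w| < rho}.
    apply: cid; have [|q] := @rat_in_itvoo R (h i w - rho) (h i w + rho).
      by rewrite ltrD2l gtrN.
    rewrite in_itv /= => /andP[? ?]; exists q; rewrite ltr_norml.
    by apply/andP; split; lra.
  pose q := [ffun i => sval (q_ex i)].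
  have qw i : `|ratr (q i) - h i w| < rho by rewrite ffunE; exact: svalP (q_ex i).
  have qO : box (q, N) `<=` O.
    move=> w' qw'; apply: rO => i /=; have := qw' i (Logic.I).
    rewrite /= in_itv /= -rhoE => /andP[? ?].
    have qi : `|ratr (q i) - h i w'| < rho by rewrite ltr_norml; apply/andP; split; lra.
    have -> : h i w - h i w' = (ratr (q i) - h i w') - (ratr (q i) - h i w) by ring.
    by apply: le_lt_trans (ler_normB _ _) _; have := qw i; lra.
  exists (q, N) => //; rewrite asboolT// => i _; rewrite /= in_itv /= -rhoE.
  by have := qw i; rewrite ltr_norml => /andP[? ?]; apply/andP; split; lra.
apply: countable_bigcupT_measurable => [|q]; first exact: countableP.
by case: asboolP.
Qed.

Lemma sum_probability_le d (T : measurableType d) (R : realType)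
    (P : probability T R) (E : nat -> set T) (K : nat) (C : R) :
  (forall k, measurable (E k)) ->
  (forall w, \sum_(k < K) \1_(E k) w <= C) ->
  (\sum_(k < K) P (E k) <= C%:E)%E.
Proof.
move=> mE EC.
have -> : (\sum_(k < K) P (E k) = \int[P]_w \sum_(k < K) (\1_(E k) w)%:E)%E.
  rewrite ge0_integral_sum//.
    by apply: eq_bigr => k _; rewrite integral_indic// setIT.
  by move=> k; apply/measurable_EFinP; exact: measurable_indic.
apply: (@le_trans _ _ (\int[P]_w cst C%:E w)%E); last first.
  rewrite integral_cst// [X in (_ * X)%E](_ : _ = 1%E) ?mule1//.
  exact: probability_setT.
apply: ge0_le_integral => //.
- by move=> w _; apply: sume_ge0.
- by apply: emeasurable_sum => k; apply/measurable_EFinP; exact: measurable_indic.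
- by move=> w _; rewrite sumEFin lee_fin.
Qed.

(** * Almost sure convergence *)

Section Convergence.
Variables (R : realType) (n : nat) (e : rel 'I_n) (Q : problem R n)
  (B : barriers Q).
Hypotheses (e_graph : connected_graph e) (B_barrier : is_barrier B)
  (f_smooth_convex : forall i,
      convex_function (X Q i) (f Q i) /\ C2_on (X Q i) (f Q i))
  (g_smooth_convex : forall i (j : 'I_(ncon Q i)),
      convex_function setT (g Q i j) /\ C2_on setT (g Q i j))
  (slater : exists xs : profile Q,
      (forall i (j : 'I_(ncon Q i)), g Q i j (xs i) < 0) /\ coupling xs)
  (P_compact :
      compact (feasibleP Q : set (prod_topology (fun i => 'cV[R]_(xdim Q i)))))
  (A_full_row_rank : forall i, \rank (A Q i) = (m_in Q + m_eq Q)%N).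
Variables (c : R) (c0 : 0 < c).

(** A gain quantifies over uncountably many competitors, so measurability comes from openness in the
    coordinates of the state, by [gain_near]. The measurable space is arbitrary so that the history
    can take its place. *)
Lemma gain_measurable d (T : measurableType d) (x : T -> profile Q)
    (y : T -> alloc Q) i delta :
  (forall i r, measurable_fun setT (fun w => x w i r 0)) ->
  (forall i r, measurable_fun setT (fun w => y w i r 0)) ->
  (forall w, invariant (x w) (y w)) ->
  measurable [set w | gain e B c i delta (x w) (y w)].
Proof.
move=> mx my xy.
pose h (s : {j : 'I_n & 'I_(xdim Q j)} + 'I_n * 'I_(m_in Q + m_eq Q)) w : R :=
  match s with
  | inl t => x w (tag t) (tagged t) 0
  | inr t => y w t.1 t.2 0
  end.
apply: (measurable_initial_open (h := h)) => [[t|t]|w gw G FG hG].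
- exact: mx.
- exact: my.
- apply: (gain_near B_barrier f_smooth_convex g_smooth_convex A_full_row_rank c0
    (xb := x w) (yb := y w)) => // [j|j|j]; first by have [] := (xy w).1 j.
    apply/cvg_mxP => r k; rewrite ord1.
    exact: (hG (inl (Tagged (fun j => 'I_(xdim Q j)) r))).
  by apply/cvg_mxP => r k; rewrite ord1; exact: (hG (inr (j, r))).
Qed.

Variables (disp : measure_display) (Omega : measurableType disp)
  (P : probability Omega R) (U : nat -> Omega -> {set 'I_n})
  (x : nat -> Omega -> profile Q) (y : nat -> Omega -> alloc Q) (y0 : alloc Q).
Hypotheses (y0_feasible : feasibleY B c y0) (xy_random : random_variables U x y)
  (run : forall w, DRRA B c e y0 (U^~ w) (x^~ w) (y^~ w)).

Let V k w := \sum_i F B c i (x k w i).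

Lemma feasible_run k w : feasibleB Q (x k w) /\ feasibleP Q (x k w).
Proof.
have Bx := invariant_feasibleB (invariant_run e_graph y0_feasible (run w) k).
by split=> //; exact: feasibleB_P.
Qed.

(** The initial optimal solutions may depend on [w], but they cost no more than fixed feasible
    points of (S) at [y0]. *)
Lemma initial_cost_bounded : exists V0, forall w, V 0%N w <= V0.
Proof.
have z_ex i : {z | feasibleS Q i (y0 i) z}.
  by apply: cid; have /ereal_inf_lt[_ [z zS _] _] := y0_feasible.2 i; exists z.
exists (\sum_i F B c i (sval (z_ex i))) => w; apply: ler_sum => i _.
have [_] := x_init (run w) i; apply; rewrite (y_init (run w)).
exact: svalP (z_ex i).
Qed.

Let E delta i k := [set w | gain e B c i delta (x k w) (y k w)].

Lemma gain_event_measurable delta i k : measurable (E delta i k).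
Proof.
have [_ mx my] := xy_random; apply: gain_measurable => // w.
exact: (invariant_run e_graph y0_feasible (run w) k).
Qed.

Lemma gain_event_history delta i k : history U x y k (E delta i k).
Proof.
apply: (@gain_measurable _ (g_sigma_algebraType _) (x k) (y k)) => [j r|j r|w].
- move=> _ Y mY; rewrite setTI; apply: sub_sigma_algebra; left.
  by exists k, j, r, Y.
- move=> _ Y mY; rewrite setTI; apply: sub_sigma_algebra; right; left.
  by exists k, j, r, Y.
- exact: (invariant_run e_graph y0_feasible (run w) k).
Qed.

Variables (p : R).
Hypotheses (p0 : 0 < p) (p_sel : selection_prob_ge U x y P p).

(** On each path, telescoping the cost bounds by (V0 - v)/delta the number of times at which [i]
    gains [delta] and is selected. Taking expectations, the conditional selection probability costs
    a factor 1/p. *)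
Lemma gain_frequency delta i : 0 < delta ->
  exists C, forall K, \sum_(k < K) fine (P (E delta i k)) <= C.
Proof.
move=> d0; have [V0 V0P] := initial_cost_bounded.
have [v [_ vP _]] := Fstar_fin B_barrier f_smooth_convex g_smooth_convex slater
  P_compact c0.
pose Ak k := E delta i k `&` [set w | i \in U k w].
have mU k : measurable [set w | i \in U k w] by have [] := xy_random.
have mE := gain_event_measurable delta i.
have mA k : measurable (Ak k) by exact: measurableI.
exists ((V0 - v) / delta / p) => K; rewrite ler_pdivlMr//.
have AC w : \sum_(k < K) \1_(Ak k) w <= (V0 - v) / delta.
  rewrite ler_pdivlMr// mulr_suml.
  apply: (@le_trans _ _ (\sum_(k < K) (V k w - V k.+1 w))).
    apply: ler_sum => k _; rewrite indicE.
    have [/set_mem[gk iU]|_] := boolP (w \in Ak k).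
      by rewrite mul1r; exact: (cost_gain e_graph y0_feasible (run w) iU gk).
    rewrite mul0r subr_ge0.
    exact: (cost_nonincreasing e_graph y0_feasible (run w)).
  rewrite (eq_bigr (fun k : 'I_K => - V k.+1 w - - V k w)); last first.
    by move=> k _; rewrite opprK addrC.
  rewrite -(big_mkord xpredT (fun k => - V k.+1 w - - V k w)).
  rewrite (telescope_sumr (fun k => - V k w))//.
  have [Bx _] := feasible_run K w.
  by have := V0P w; have := vP _ Bx; rewrite -/(V K w); lra.
have := sum_probability_le P mA AC.
have fA k : P (Ak k) = (fine (P (Ak k)))%:E by rewrite fineK// fin_num_measure.
rewrite (eq_bigr (fun k : 'I_K => (fine (P (Ak k)))%:E)); last by move=> k _; exact: fA.
rewrite sumEFin lee_fin; apply: le_trans.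
rewrite mulrC mulr_sumr; apply: ler_sum => k _.
have := p_sel i (@gain_event_history delta i k).
rewrite -/(Ak k) fA -(fineK (fin_num_measure P _ (mE k))) -EFinM lee_fin.
exact.
Qed.

(** [Bad] says that some node gains at every time. Its probability is at most the sum over nodes at
    each single time, so K times it stays below a bound independent of K. *)
Lemma gain_stops delta : 0 < delta ->
  {ae P, forall w, exists k, forall i, ~ gain e B c i delta (x k w) (y k w)}.
Proof.
move=> d0.
have /choice[C CP] := fun i => gain_frequency i d0.
pose Bad := \bigcap_k \big[setU/set0]_(i < n) E delta i k.
have mE k i : measurable (E delta i k) by exact: gain_event_measurable.
have mU k : measurable (\big[setU/set0]_(i < n) E delta i k).
  by apply: bigsetU_measurable => i _; exact: mE.
have mBad : measurable Bad by exact: bigcapT_measurable.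
suff Bad0 : P Bad = 0%E.
  exists Bad; split=> // w /= nw k _; apply: contrapT => nE.
  by apply: nw; exists k => i gi; apply: nE; rewrite (bigD1 i)//=; left.
have BadK k : fine (P Bad) <= \sum_(i < n) fine (P (E delta i k)).
  rewrite -lee_fin fineK ?fin_num_measure// -sumEFin.
  rewrite (eq_bigr (fun i => P (E delta i k))); last first.
    by move=> i _; rewrite fineK ?fin_num_measure.
  apply: (@le_trans _ _ (P (\big[setU/set0]_(i < n) E delta i k))).
    by apply: le_measure; rewrite ?inE// => w; exact.
  have [] : measurable (\big[setU/set0]_(i < n) E delta i k) /\
      (P (\big[setU/set0]_(i < n) E delta i k) <= \sum_(i < n) P (E delta i k))%E.
    apply: (big_ind2 (fun A s => measurable A /\ (P A <= s)%E)).
    - by split=> //; rewrite measure0.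
    - move=> S s S' s' [mS Ss] [mS' Ss']; split; first exact: measurableU.
      apply: le_trans (leeD Ss Ss').
      exact: measureU2.
    - by move=> i _; split; [exact: mE|].
  by [].
have KBad K : K%:R * fine (P Bad) <= \sum_i C i.
  rewrite mulr_natl -[K in _ *+ K]card_ord -sumr_const.
  apply: (@le_trans _ _ (\sum_(k < K) \sum_(i < n) fine (P (E delta i k)))).
    by apply: ler_sum => k _; exact: BadK.
  by rewrite exchange_big; apply: ler_sum => i _; exact: CP.
rewrite -(fineK (fin_num_measure P _ mBad)); congr (_%:E); apply/eqP.
rewrite eq_le fine_ge0// andbT leNgt; apply/negP => b0.
have := archi_boundP (_ : 0 <= `|\sum_i C i| / fine (P Bad)).
rewrite divr_ge0 ?(ltW b0)// => /(_ isT).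
rewrite ltr_pdivrMr// => /(le_lt_trans (ler_norm _)).
by move=> /lt_le_trans/(_ (KBad _)); rewrite ltxx.
Qed.

Lemma cost_cvg : {ae P, forall w, (V k w)%:E @[k --> \oo] --> Fstar B c}.
Proof.
have [v [-> vP vmax]] := Fstar_fin B_barrier f_smooth_convex g_smooth_convex
  slater P_compact c0.
have [V0 V0P] := initial_cost_bounded.
(* The tolerances 1/(m+1) leave only countably many almost sure events to intersect; monotonicity of
   the cost then gives convergence. *)
have near_v (m : nat) : {ae P, forall w, exists k, V k w < v + m.+1%:R^-1}.
  have m0 : 0 < m.+1%:R^-1 :> R by rewrite invr_gt0.
  have [delta d0 dP] := gain_uniform e_graph B_barrier f_smooth_convex
    g_smooth_convex slater P_compact A_full_row_rank c0 V0 m0 vmax.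
  apply: filterS (gain_stops d0) => w [k nk]; exists k; rewrite ltNge.
  apply/negP => vV.
  have VV0 : V k w <= V0.
    exact: le_trans (cost_le e_graph y0_feasible (run w) (leq0n k)) (V0P w).
  have [i] := dP (x k w) (y k w) (invariant_run e_graph y0_feasible (run w) k) VV0 vV.
  exact: nk.
apply: filterS (ae_foralln near_v) => w Vw.
apply: cvg_EFin; first exact: nearW.
apply/cvgrPdist_lt => eps eps0.
have [m _ /(_ m) m_small] := cvgr_lt _ (@cvg_harmonic R) _ eps0.
have [k kV] := Vw m.
exists k => // j /= kj; have [Bx _] := feasible_run j w.
have vj : v <= V j w by exact: vP.
rewrite distrC ger0_norm ?subr_ge0// ltrBlDl.
apply: le_lt_trans (cost_le e_graph y0_feasible (run w) kj) _.
by apply: lt_trans kV _; rewrite ltrD2l; apply: m_small => /=.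
Qed.

End Convergence.

(** * Small barrier parameters *)

Lemma limn_esup_le (R : realType) (u : nat -> \bar R) (M : \bar R) :
  (\forall k \near \oo, (u k <= M)%E) -> (limn_esup u <= M)%E.
Proof.
move=> [N _ uN]; apply: (@le_trans _ _ (ereal_sup (u @` [set k | (N <= k)%N]))).
  by apply: ereal_inf_lbound; exists [set k | (N <= k)%N] => //; exists N.
by apply: ge_ereal_sup => _ [k /= Nk <-]; exact: uN.
Qed.

Section BarrierParameter.
Variables (R : realType) (n : nat) (Q : problem R n) (B : barriers Q).
Hypotheses (B_barrier : is_barrier B)
  (f_smooth_convex : forall i,
      convex_function (X Q i) (f Q i) /\ C2_on (X Q i) (f Q i))
  (g_smooth_convex : forall i (j : 'I_(ncon Q i)),
      convex_function setT (g Q i j) /\ C2_on setT (g Q i j))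
  (slater : exists xs : profile Q,
      (forall i (j : 'I_(ncon Q i)), g Q i j (xs i) < 0) /\ coupling xs)
  (P_compact :
      compact (feasibleP Q : set (prod_topology (fun i => 'cV[R]_(xdim Q i))))).

Lemma fstar_fin : fstar Q \is a fin_num.
Proof.
have [xs xsP] := slater;
  have [L LP] := f_lbound f_smooth_convex g_smooth_convex slater P_compact.
rewrite fin_numElt; apply/andP; split.
  apply: (lt_le_trans (ltNyr (\sum_i L i))); apply: le_ereal_inf_tmp => _ [z Pz <-].
  by rewrite lee_fin; apply: ler_sum => i _; exact: LP.
apply: (le_lt_trans _ (ltry (\sum_i f Q i (xs i)))); apply: ereal_inf_lbound.
by exists xs => //; exact: feasibleB_P.
Qed.

(** Any positive weight on the strictly feasible point makes the convex constraints strict. *)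
Lemma feasible_segment (xs z : profile Q) t : feasibleB Q xs -> feasibleP Q z ->
  0 < t <= 1 -> feasibleB Q (fun i => t *: xs i + (1 - t) *: z i).
Proof.
move=> [Xs /coupling_slack cs] [Xz /coupling_slack cz] /andP[t0 t1].
have t01 : 0 <= t <= 1 by rewrite ltW.
split=> [i j|].
  have [gc _] := g_smooth_convex j.
  apply: le_lt_trans (@convex_functionP _ _ _ _ (z i) (xs i) t gc I I t01) _.
  have : t * g Q i j (xs i) < 0 by rewrite pmulr_rlt0//; exact: Xs.
  have : (1 - t) * g Q i j (z i) <= 0 by rewrite mulr_ge0_le0 ?subr_ge0//; exact: Xz.
  lra.
apply/coupling_slack.
rewrite (_ : _ - _ = t *: (b Q - \sum_i A Q i *m xs i) +
                     (1 - t) *: (b Q - \sum_i A Q i *m z i)).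
  by apply: slackD; apply: slackZ => //; rewrite ?subr_ge0// ltW.
under eq_bigr do rewrite mulmxDr -!scalemxAr.
rewrite big_split -!scaler_sumr /= !scalerBr addrACA -scalerDl -opprD.
by rewrite [t + _]addrC subrK scale1r.
Qed.

Lemma strictly_feasible_near_optimal eps : 0 < eps ->
  exists2 z, feasibleB Q z & ((\sum_i f Q i (z i))%:E <= fstar Q + eps%:E)%E.
Proof.
move=> eps0; have [xs xsP] := slater.
have e2 : 0 < eps / 2 by rewrite divr_gt0.
have [_ [z Pz <-] zlt] := lb_ereal_inf_adherent e2 fstar_fin.
have {zlt} : ((\sum_i f Q i (z i))%:E < fstar Q + (eps / 2)%:E)%E by [].
rewrite -(fineK fstar_fin) -!EFinD lte_fin => zlt.
pose D := `|\sum_i f Q i (xs i) - \sum_i f Q i (z i)|.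
have D0 : 0 <= D by exact: normr_ge0.
have eD : 0 < eps / 2 + D by exact: ltr_wpDr.
(* A weight in (0, 1], also when D = 0, for which moving towards the Slater point costs at most t D
   <= eps/2. *)
pose t := (eps / 2) / (eps / 2 + D).
have t0 : 0 < t by rewrite divr_gt0.
have t1 : t <= 1 by rewrite ler_pdivrMr// mul1r lerDl.
have tD : t * D <= eps / 2.
  rewrite -mulrA ler_piMr ?(ltW e2)// mulrC ler_pdivrMr// mul1r lerDr ltW//.
have t01 : 0 <= t <= 1 by rewrite ltW.
exists (fun i => t *: xs i + (1 - t) *: z i).
  by apply: feasible_segment => //; rewrite t0.
have fc : \sum_i f Q i (t *: xs i + (1 - t) *: z i) <=
    \sum_i f Q i (z i) + t * (\sum_i f Q i (xs i) - \sum_i f Q i (z i)).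
  rewrite mulrBr !mulr_sumr -sumrB -big_split /=; apply: ler_sum => i _.
  have [fcv _] := f_smooth_convex i.
  have := @convex_functionP _ _ _ _ (z i) (xs i) t fcv
    (Pz.1 i) ((feasibleB_P xsP).1 i) t01.
  by move=> /le_trans; apply; lra.
have tn : t * (\sum_i f Q i (xs i) - \sum_i f Q i (z i)) <= eps / 2.
  by apply: le_trans tD; rewrite ler_pM2l// ler_norm.
by rewrite lee_fin; apply: le_trans fc _; lra.
Qed.

(* For small c, the barrier term of a fixed strictly feasible near-optimal point
   exceeds its lower bound over the whole feasible set by little. *)
Lemma barrier_suboptimality eps : 0 < eps -> exists2 cbar : R, 0 < cbar &
  forall c, 0 < c -> c <= cbar -> forall x : nat -> profile Q,
    (forall k, feasibleB Q (x k)) ->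
    (\sum_i F B c i (x k i))%:E @[k --> \oo] --> Fstar B c ->
    (limn_esup (fun k => (\sum_i f Q i (x k i))%:E) <= fstar Q + eps%:E)%E.
Proof.
move=> eps0; have e3 : 0 < eps / 3 by rewrite divr_gt0.
have [z Bz fz] := strictly_feasible_near_optimal e3.
have [L LP] := B_lbound B_barrier g_smooth_convex slater P_compact.
pose bs (w : profile Q) := \sum_i \sum_j B j (w i).
pose Lb := \sum_i \sum_j L i j.
have Lbs w : feasibleB Q w -> Lb <= bs w.
  by move=> Bw; apply: ler_sum => i _; apply: ler_sum => j _; exact: LP.
have FE c w : \sum_i F B c i (w i) = \sum_i f Q i (w i) + c * bs w.
  by rewrite /bs mulr_sumr -big_split.
have d0 : 0 < bs z - Lb + 1 by have := Lbs z Bz; lra.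
(* This makes c (bs z - Lb) at most eps/3; the added 1 keeps the divisor positive. The other two
   thirds pay for the suboptimality of [z] and for the approach to the limit. *)
exists (eps / 3 / (bs z - Lb + 1)); first by rewrite divr_gt0.
move=> c c0; rewrite ler_pdivlMr// => cb x Bx.
have [v [-> vP _]] := Fstar_fin B_barrier f_smooth_convex g_smooth_convex slater
  P_compact c0.
(* Convergence is known for the barrier cost; the part in [f] is bounded for all large k, which
   bounds its limit superior. *)
move=> /fine_cvgP[_ /= Vv]; apply: limn_esup_le.
have near_v : \forall k \near \oo, \sum_i F B c i (x k i) <= v + eps / 3.
  by apply: (cvgr_le _ Vv); rewrite ltrDl.
apply: filterS near_v => k; rewrite FE => Vk.
have vz := vP z Bz; rewrite FE in vz.
move: fz; rewrite -(fineK fstar_fin) -!EFinD !lee_fin => fz.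
have cL : c * Lb <= c * bs (x k) by rewrite ler_pM2l//; exact: Lbs.
by move: cb; rewrite mulrDr mulr1 mulrBr; lra.
Qed.

End BarrierParameter.

Theorem theorem1 (R : realType) (n : nat) (e : rel 'I_n) (Q : problem R n)
    (B : barriers Q)
    (e_graph : connected_graph e)
    (B_barrier : is_barrier B)
    (f_smooth_convex : forall i,
      convex_function (X Q i) (f Q i) /\ C2_on (X Q i) (f Q i))
    (g_smooth_convex : forall i (j : 'I_(ncon Q i)),
      convex_function setT (g Q i j) /\ C2_on setT (g Q i j))
    (slater : exists xs : profile Q,
      (forall i (j : 'I_(ncon Q i)), g Q i j (xs i) < 0) /\ coupling xs)
    (P_compact :
      compact (feasibleP Q : set (prod_topology (fun i => 'cV[R]_(xdim Q i)))))
    (A_full_row_rank : forall i, \rank (A Q i) = (m_in Q + m_eq Q)%N) :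
  (forall c : R, 0 < c ->
   forall (disp : measure_display) (Omega : measurableType disp)
     (P : probability Omega R) (U : nat -> Omega -> {set 'I_n})
     (x : nat -> Omega -> profile Q) (y : nat -> Omega -> alloc Q) (y0 : alloc Q),
   feasibleY B c y0 ->
   random_variables U x y ->
   (forall w, DRRA B c e y0 (U^~ w) (x^~ w) (y^~ w)) ->
   (exists2 p : R, 0 < p & selection_prob_ge U x y P p) ->
   (forall k w, feasibleB Q (x k w) /\ feasibleP Q (x k w)) /\
   {ae P, forall w,
     (\sum_i F B c i (x k w i))%:E @[k --> \oo] --> Fstar B c})
  /\
  (forall eps : R, 0 < eps ->
   exists2 cbar : R, 0 < cbar &
   forall c : R, 0 < c -> c <= cbar ->
   forall (disp : measure_display) (Omega : measurableType disp)
     (P : probability Omega R) (U : nat -> Omega -> {set 'I_n})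
     (x : nat -> Omega -> profile Q) (y : nat -> Omega -> alloc Q) (y0 : alloc Q),
   feasibleY B c y0 ->
   random_variables U x y ->
   (forall w, DRRA B c e y0 (U^~ w) (x^~ w) (y^~ w)) ->
   (exists2 p : R, 0 < p & selection_prob_ge U x y P p) ->
   {ae P, forall w,
     (limn_esup (fun k => (\sum_i f Q i (x k w i))%:E) <= fstar Q + eps%:E)%E}).

Proof.
split=> [c c0 disp Omega P U x y y0 y0f xyr run [p p0 psel]|eps eps0].
  split=> [k w|]; first exact: (feasible_run e_graph y0f run).
  exact: (cost_cvg e_graph B_barrier f_smooth_convex g_smooth_convex slater
    P_compact A_full_row_rank c0 y0f xyr run p0 psel).
(* The threshold comes from a deterministic statement, hence is uniform over probability spaces and
   runs. *)
have [cbar cbar0 cbarP] := barrier_suboptimality B_barrier f_smooth_convex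
  g_smooth_convex slater P_compact eps0.
exists cbar => // c c0 ccbar disp Omega P U x y y0 y0f xyr run [p p0 psel].
have := cost_cvg e_graph B_barrier f_smooth_convex g_smooth_convex slater
  P_compact A_full_row_rank c0 y0f xyr run p0 psel.
apply: filterS => w; apply: (cbarP c c0 ccbar (fun k => x k w)) => k.
by have [] := feasible_run e_graph y0f run k w.
Qed.
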